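(* Let $G$ be a connected Lie group with Lie algebra $\mathfrak g$, furnished with a bi-invariant Finsler metric $F$. Then every nonzero vector $X\in\mathfrak g$ is a geodesic vector, i.e. the curve $t\mapsto\exp(tX)$ is a constant speed geodesic of $(G,F)$.
   Context: A Finsler metric on a smooth manifold $M$ is a continuous function $F:TM\to[0,\infty)$, smooth on $TM\setminus\{0\}$, positively homogeneous of degree one ($F(tu)=tF(u)$ for $t\ge 0$; not necessarily reversible), such that for every $y\in T_xM\setminus\{0\}$ the symmetric bilinear form $g_y(u,v)=\frac12\frac{\partial^2}{\partial s\partial t}F^2(x,y+su+tv)\big|_{s=t=0}$ on $T_xM$ is positive definite. Geodesics are the Finslerian (constant speed) geodesics, i.e. curves $\sigma$ with velocity $T=\dot\sigma$ satisfying $D_TT=0$ with reference vector $T$ for the Chern connection. A Finsler metric on a Lie group is bi-invariant if all left translations and all right translations are isometries, i.e. their differentials preserve $F$. Here $G$ is viewed as the homogeneous space $G/\{e\}$ with origin $e$, $G$ acting by left translations. A nonzero $X\in\mathfrak g$ is a geodesic vector if $t\mapsto\exp(tX)(e)=\exp(tX)$ is a constant speed geodesic. *)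

(* Defs.v *)
From HB Require Import structures.
From mathcomp Require Import all_boot all_order all_algebra.
From mathcomp Require Import all_classical all_reals all_analysis.

Set Implicit Arguments.
Unset Strict Implicit.
Unset Printing Implicit Defensive.

Import Order.TTheory GRing.Theory Num.Theory.
Import numFieldNormedType.Exports.

Local Open Scope classical_set_scope.
Local Open Scope ring_scope.

(* [U] is meant to be open, [E] and [F] finite-dimensional. In finite dimension
   the derivative [x |-> 'd f x] is C^k iff [x |-> 'd f x v] is C^k for each
   fixed [v]. *)
Fixpoint Ck_on (R : realType) (E F : normedModType R) (k : nat)
    (U : set E) (f : E -> F) : Prop :=
  match k with
  | 0%N => forall x, U x -> {for x, continuous f}
  | k'.+1 => (forall x, U x -> differentiable f x) /\
             (forall v : E, Ck_on k' U (fun x => 'D_v f x))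
  end.

Definition smooth_on (R : realType) (E F : normedModType R)
    (U : set E) (f : E -> F) : Prop :=
  forall k, Ck_on k U f.

(* A homeomorphism from an open subset of [M] onto an open subset of R^n; both
   directions are total functions whose values off [dom] and off
   [cmap @` dom] are irrelevant. *)
Record chart (R : realType) (n : nat) (M : topologicalType) := Chart {
  dom : set M;
  cmap : M -> 'rV[R]_n;
  cinv : 'rV[R]_n -> M;
  dom_open : open dom;
  target_open : open (cmap @` dom);
  cmapK : forall x, dom x -> cinv (cmap x) = x;
  cmap_continuous : forall x, dom x -> {for x, continuous cmap};
  cinv_continuous : forall p, (cmap @` dom) p -> {for p, continuous cinv}
}.

Definition target (R : realType) (n : nat) (M : topologicalType)
  (phi : chart R n M) : set 'rV[R]_n := cmap phi @` dom phi.

(* [chart_at x] is an arbitrary chart of the atlas around [x]; it only serves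
   to coordinatize the tangent space at [x], see [tangent]. *)
HB.mixin Record isManifold (R : realType) (n : nat) M of Topological M := {
  atlas : set (chart R n M);
  chart_at : M -> chart R n M;
  chart_at_atlas : forall x, atlas (chart_at x);
  chart_at_dom : forall x, dom (chart_at x) x;
  transition_smooth : forall phi psi, atlas phi -> atlas psi ->
    smooth_on (cmap phi @` (dom phi `&` dom psi)) (cmap psi \o cinv phi);
  manifold_hausdorff : hausdorff_space M;
  manifold_second_countable : @second_countable M
}.

#[short(type="manifoldType")]
HB.structure Definition Manifold (R : realType) (n : nat) :=
  {M of isManifold R n M & Topological M}.

HB.mixin Record isLieGroup (R : realType) (n : nat) G
    of Manifold R n G & Group G := {
  lie_mul_continuous : continuous (fun z : G * G => (z.1 * z.2)%g);
  lie_inv_continuous : continuous (fun x : G => x^-1%g);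
  lie_mul_smooth : forall phi psi chi : chart R n G,
    atlas phi -> atlas psi -> atlas chi ->
    smooth_on
      [set z : 'rV[R]_n * 'rV[R]_n | [/\ target phi z.1, target psi z.2
         & dom chi (cinv phi z.1 * cinv psi z.2)%g]]
      (fun z => cmap chi (cinv phi z.1 * cinv psi z.2)%g);
  lie_inv_smooth : forall phi chi : chart R n G, atlas phi -> atlas chi ->
    smooth_on [set p | target phi p /\ dom chi (cinv phi p)^-1%g]
      (fun p => cmap chi (cinv phi p)^-1%g)
}.

#[short(type="lieGroupType")]
HB.structure Definition LieGroup (R : realType) (n : nat) :=
  {G of isLieGroup R n G & Manifold R n G & Group G}.

Section Manifolds.
Context {R : realType} {n : nat}.
Local Notation E := 'rV[R]_n.

(* The tangent space at [x] is R^n, a vector being identified with its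
   components in the chart [chart_at x]; components in another chart are
   obtained by applying the differential of the transition map. *)
Definition tangent (M : manifoldType R n) (x : M) : normedModType R := E.

(* The tangent vector at [x] with components [y] in the chart [phi]. *)
Definition vec_of_chart (M : manifoldType R n) (phi : chart R n M) (x : M)
    (y : E) : tangent x :=
  'd (cmap (chart_at x) \o cinv phi) (cmap phi x) y.

Definition mdiff (M N : manifoldType R n) (f : M -> N) (x : M) :
    tangent x -> tangent (f x) :=
  'd (cmap (chart_at (f x)) \o f \o cinv (chart_at x)) (cmap (chart_at x) x).

Definition smooth_curve (M : manifoldType R n) (c : R -> M) : Prop :=
  continuous c /\
  forall phi : chart R n M, atlas phi ->
    smooth_on (E := R^o) (c @^-1` dom phi) (cmap phi \o c).

Definition velocity (M : manifoldType R n) (c : R -> M) (t : R) :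
    tangent (c t) :=
  derive1 (cmap (chart_at (c t)) \o c) t.

End Manifolds.

Section Finsler.
Context {R : realType} {n : nat}.
Local Notation E := 'rV[R]_n.

(* 1/2 d^2/dsdt f^2 (y + s u + t v) at s = t = 0, for [f] on one tangent
   space. *)
Definition fundamental_tensor (V : normedModType R) (f : V -> R)
    (y u v : V) : R :=
  2^-1 * derive1 (fun s : R =>
           derive1 (fun t : R => (f (y + s *: u + t *: v) ^+ 2 : R^o)) 0) 0.

(* [F] in the coordinates (p, y) on TM induced by the chart [phi]. *)
Definition local_rep (M : manifoldType R n)
    (F : forall x : M, tangent x -> R) (phi : chart R n M) (z : E * E) : R^o :=
  F (cinv phi z.1) (vec_of_chart phi (cinv phi z.1) z.2).

Definition finsler_metric (M : manifoldType R n)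
    (F : forall x : M, tangent x -> R) : Prop :=
  [/\ (forall x (y : tangent x), 0 <= F x y),
      (forall phi : chart R n M, atlas phi ->
         forall z, target phi z.1 -> {for z, continuous (local_rep F phi)}),
      (forall phi : chart R n M, atlas phi ->
         smooth_on [set z : E * E | target phi z.1 /\ z.2 != 0]
           (local_rep F phi)),
      (forall x (y : tangent x) (t : R), 0 <= t -> F x (t *: y) = t * F x y)
    & (forall x (y u : tangent x), y != 0 -> u != 0 ->
         0 < fundamental_tensor (F x) y u u)].

(* Chern connection coefficients of a Finsler function [f (p, y)] on an open
   subset of R^n, as in Bao, Chern and Shen, An Introduction to
   Riemann-Finsler Geometry, chapter 2. *)
Section ChernConnection.
Variable f : E * E -> R.

Definition ebase (i : 'I_n) : E := delta_mx 0 i.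

Definition dx (k : 'I_n) (h : E * E -> R) (z : E * E) : R :=
  'D_(ebase k, 0 : E) (h : E * E -> R^o) z.

Definition dy (k : 'I_n) (h : E * E -> R) (z : E * E) : R :=
  'D_(0 : E, ebase k) (h : E * E -> R^o) z.

Definition g_lo (i j : 'I_n) (z : E * E) : R :=
  fundamental_tensor (fun y => f (z.1, y)) z.2 (ebase i) (ebase j).

Definition g_up (i j : 'I_n) (z : E * E) : R :=
  invmx (\matrix_(k, l) g_lo k l z) i j.

Definition formal_christoffel (i j k : 'I_n) (z : E * E) : R :=
  2^-1 * \sum_s g_up i s z *
    (dx k (g_lo s j) z - dx s (g_lo j k) z + dx j (g_lo k s) z).

(* C^i_jk, where C_ijk = 1/2 d g_ij / d y^k *)
Definition cartan_tensor (i j k : 'I_n) (z : E * E) : R :=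
  2^-1 * \sum_s g_up i s z * dy k (g_lo s j) z.

(* N^i_j = gamma^i_jk y^k - C^i_jk gamma^k_rs y^r y^s *)
Definition nonlinear_connection (i j : 'I_n) (z : E * E) : R :=
  \sum_k formal_christoffel i j k z * z.2 0 k -
  \sum_k cartan_tensor i j k z *
    \sum_r \sum_s formal_christoffel k r s z * z.2 0 r * z.2 0 s.

(* delta / delta x^k = d / d x^k - N^l_k d / d y^l *)
Definition delta_x (k : 'I_n) (h : E * E -> R) (z : E * E) : R :=
  dx k h z - \sum_l nonlinear_connection l k z * dy l h z.

Definition chern_coef (i j k : 'I_n) (z : E * E) : R :=
  2^-1 * \sum_s g_up i s z *
    (delta_x k (g_lo s j) z - delta_x s (g_lo j k) z + delta_x j (g_lo k s) z).

(* Covariant derivative along the curve [c], with reference vector [W], of the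
   vector field [V] along [c]:
   (D_T V)^i = dV^i/dt + Gamma^i_jk(c, W) V^j T^k with T = dc/dt. *)
Definition chern_covariant (c W V : R -> E) (t : R) : E :=
  derive1 V t +
  \row_i \sum_j \sum_k
    chern_coef i j k (c t, W t) * V t 0 j * derive1 c t 0 k.

End ChernConnection.

(* D_T T = 0 with reference vector T, expressed in every chart; T must not
   vanish for the reference vector to be admissible. *)
Definition finsler_geodesic (M : manifoldType R n)
    (F : forall x : M, tangent x -> R) (c : R -> M) : Prop :=
  [/\ smooth_curve c,
      (forall t, velocity c t != 0)
    & (forall (phi : chart R n M) t, atlas phi -> dom phi (c t) ->
         let T := derive1 (cmap phi \o c) in
         chern_covariant (local_rep F phi) (cmap phi \o c) T T t = 0)].

Definition constant_speed_geodesic (M : manifoldType R n)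
    (F : forall x : M, tangent x -> R) (c : R -> M) : Prop :=
  finsler_geodesic F c /\ exists a : R, forall t, F (c t) (velocity c t) = a.

End Finsler.

Section LieGroups.
Context {R : realType} {n : nat}.
Variable G : lieGroupType R n.

(* As a vector space; the bracket is not needed. *)
Definition lie_algebra : normedModType R := tangent (1%g : G).

Definition one_parameter_subgroup (X : lie_algebra) (c : R -> G) : Prop :=
  [/\ smooth_curve c,
      (forall s t, c (s + t) = (c s * c t)%g)
    & velocity c 0 = X :> 'rV[R]_n].

(* exp X = c 1 for the one-parameter subgroup [c] with initial velocity [X] *)
Definition lie_exp (X : lie_algebra) : G :=
  xget 1%g [set x | exists2 c : R -> G, one_parameter_subgroup X c & x = c 1].

Definition bi_invariant (F : forall x : G, tangent x -> R) : Prop :=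
  (forall (a x : G) (v : tangent x),
     F (a * x)%g (mdiff (fun y : G => (a * y)%g) v) = F x v) /\
  (forall (a x : G) (v : tangent x),
     F (x * a)%g (mdiff (fun y : G => (y * a)%g) v) = F x v).

Definition geodesic_vector (F : forall x : G, tangent x -> R)
    (X : lie_algebra) : Prop :=
  X != 0 /\ constant_speed_geodesic F (fun t : R => lie_exp (t *: X)).

End LieGroups.

(* Main.v *)
(* Let V be the left-invariant field with V(e) = X; its integral curves are the
   curves a exp(tX), and its flow is r -> R_{exp(rX)}. Write S = F^2 in a chart.
   Left invariance of F says that S(p, V(p)) is constant; right invariance says
   that the flow of V preserves S. With m(p, q) the product in charts and B the
   mixed second derivative of m at (p, e) in the directions (w, 0) and (0, X),
   differentiating the two statements in the direction w gives
     S_x[w] + S_y[B] = 0   and   d/dt (S_y(c, c'))[w] + S_y[B] = 0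
   along c(t) = exp(tX), because B is at once the derivative of V along w and the
   derivative along the flow of the transported vector w. Hence c satisfies the
   Euler-Lagrange equation of F^2. By Euler's identities for the 2-homogeneous S,
   the Chern connection contracted twice with the velocity reduces to the
   geodesic spray, and the two equations agree since g is invertible. The
   existence and uniqueness of exp(tX) come from Picard iteration near e. *)

Require Import Defs.
From HB Require Import structures.
From mathcomp Require Import all_boot all_order all_algebra.
From mathcomp Require Import all_classical all_reals all_analysis.
From mathcomp Require Import ring lra.

Set Implicit Arguments.
Unset Strict Implicit.
Unset Printing Implicit Defensive.

Import Order.TTheory GRing.Theory Num.Theory.
Import numFieldNormedType.Exports.

Local Open Scope classical_set_scope.
Local Open Scope ring_scope.

(** * Differential calculus of class C^k *)

(** [lie_exp] is specified by choice: [lie_exp (t *: X)] is the value at time 1 of some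
    one-parameter subgroup for [t *: X], and 1 if there is none. Before any geometry, the curve t
    |-> exp(tX) must therefore be identified with a single subgroup c, which takes existence and
    uniqueness for every [t *: X]. Picard iteration yields only a local solution u in the chart at
    e. Uniqueness, applied to u(s + q) and u(s)u(q) as functions of q, makes it a local
    homomorphism, and the group law replaces continuation of solutions: c(t) is the k-th power of
    the local value at t/k, for k large. Smoothness of c is bootstrapped afterwards from the
    equation. The flow of V calls for no theorem on dependence on initial data: it is right
    translation, so the smoothness of the product makes it smooth in time and space together. Charts
    are total maps with arbitrary values off their domains, so coordinate expressions compose
    correctly only near a point; hence the constant recourse to equality of germs. *)

Section NearEquality.
Context {R : realType} {V W : normedModType R}.
Implicit Types f g : V -> W.

(** The differential is a chosen value, so two germs are compared through the little-o expansion,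
    which is local and determines the differential uniquely. *)
Lemma near_eq_is_diff f g x :
  (\near x, f x = g x) -> differentiable f x -> is_diff x g ('d f x).
Proof.
move=> fg df.
have fgx : f x = g x by exact: nbhs_singleton fg.
have dfc : continuous 'd f x by have [] := (diff_locallyP x f).1 df.
have eg : g \o shift x = cst (g x) + 'd f x +o_ (0 : V) id.
  have := diff_locally df => /eqaddoP H.
  apply/eqaddoP => e e0.
  have fg' : \forall h \near (0 : V), f (h + x) = g (h + x).
    by move: fg; rewrite (near_shift 0 x) /= subr0.
  by apply: filterS2 fg' (H e e0) => h; rewrite !fctE /= -fgx => ->.
have dgE := diff_unique dfc eg.
apply: DiffDef; last exact: dgE.
by apply/diff_locallyP; rewrite dgE; split.
Qed.

Lemma near_eq_differentiable f g x :
  (\near x, f x = g x) -> differentiable f x -> differentiable g x.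
Proof. by move=> fg df; have [] := near_eq_is_diff fg df. Qed.

Lemma near_eq_diff f g x :
  (\near x, f x = g x) -> differentiable f x -> 'd f x = 'd g x :> (V -> W).
Proof. by move=> fg df; have [_ ->] := near_eq_is_diff fg df. Qed.

Lemma open_near_eq (U : set V) f g x :
  open U -> (forall x, U x -> f x = g x) -> U x -> \near x, f x = g x.
Proof.
by move=> oU fg Ux; near=> y; apply: fg; near: y; exact: open_nbhs_nbhs.
Unshelve. all: by end_near. Qed.

End NearEquality.

Section Ck.
Context {R : realType}.
Implicit Types E F H : normedModType R.

Lemma Ck_on_sub E F k (U U' : set E) (f : E -> F) :
  U' `<=` U -> Ck_on k U f -> Ck_on k U' f.
Proof.
move=> sub; elim: k f => [|k IH] f /=; first by move=> H x /sub /H.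
by move=> [df Df]; split=> [x /sub /df|v]; [|exact: IH].
Qed.

Lemma eq_Ck_on E F k (U : set E) (f g : E -> F) :
  open U -> (forall x, U x -> f x = g x) -> Ck_on k U f -> Ck_on k U g.
Proof.
move=> oU; elim: k f g => [|k IH] f g fg /=.
  move=> cf x Ux; have nfg := open_near_eq oU fg Ux.
  suff : g z @[z --> x] --> g x by [].
  rewrite -(fg _ Ux).
  by apply: cvg_trans (cf x Ux); apply: near_eq_cvg.
move=> [df Df]; split=> [x Ux|v].
  exact: near_eq_differentiable (open_near_eq oU fg Ux) (df x Ux).
apply: IH (Df v) => x Ux.
exact/near_eq_derive/(open_near_eq oU fg Ux).
Qed.

Lemma Ck_on_continuous E F k (U : set E) (f : E -> F) :
  Ck_on k U f -> forall x, U x -> {for x, continuous f}.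
Proof.
by case: k => [|k] //= [df _] x Ux; apply: differentiable_continuous; exact: df.
Qed.

Lemma Ck_on_pred E F k (U : set E) (f : E -> F) :
  Ck_on k.+1 U f -> Ck_on k U f.
Proof.
elim: k f => [|k IH] f.
  by move=> H x Ux; exact: (Ck_on_continuous H).
by move=> [df Df]; split=> // v; exact: IH.
Qed.

Lemma Ck_on_cst E F k (U : set E) (a : F) : Ck_on k U (cst a : E -> F).
Proof.
elim: k a => [|k IH] a /=; first by move=> x _; exact: cvg_cst.
split=> [x _|v]; first exact: differentiable_cst.
rewrite (_ : (fun x => 'D_v (cst a) x) = cst 0); first exact: IH.
by apply/funext => x; rewrite derive_cst.
Qed.

Lemma Ck_onD E F k (U : set E) (f g : E -> F) :
  open U -> Ck_on k U f -> Ck_on k U g -> Ck_on k U (f + g).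
Proof.
move=> oU; elim: k f g => [|k IH] f g /=.
  by move=> cf cg x Ux; apply: continuousD; [exact: cf|exact: cg].
move=> [df Df] [dg Dg]; split=> [x Ux|v].
  by apply: differentiableD; [exact: df|exact: dg].
apply: eq_Ck_on (IH _ _ (Df v) (Dg v)) => // x Ux /=.
by rewrite deriveD //; apply: diff_derivable; [exact: df|exact: dg].
Qed.

Lemma Ck_on_sum E F k (U : set E) m (f : 'I_m -> E -> F) :
  open U -> (forall i, Ck_on k U (f i)) -> Ck_on k U (\sum_(i < m) f i).
Proof.
move=> oU H; elim/big_ind: _ => //; first exact: Ck_on_cst.
by move=> g h; exact: Ck_onD.
Qed.

Lemma Ck_onM E k (U : set E) (f g : E -> R^o) :
  open U -> Ck_on k U f -> Ck_on k U g -> Ck_on k U (f * g : E -> R^o).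
Proof.
move=> oU; elim: k f g => [|k IH] f g.
  by move=> cf cg x Ux; apply: continuousM; [exact: cf|exact: cg].
move=> Hf Hg; have [df Df] := Hf; have [dg Dg] := Hg; split=> [x Ux|v].
  by apply: differentiableM; [exact: df|exact: dg].
(* The product rule keeps one factor undifferentiated, so its class is lowered to k before the
   induction hypothesis applies. *)
apply: eq_Ck_on (Ck_onD oU (IH _ _ (Ck_on_pred Hf) (Dg v))
  (IH _ _ (Ck_on_pred Hg) (Df v))) => // x Ux /=.
by rewrite deriveM //; apply: diff_derivable; [exact: df|exact: dg].
Qed.

(* [derivable] and [derive] see a function only through the lines
   [h |-> f (h *: v + x)], hence the unconditional equality. *)
Lemma derive_comp_affine E E' F (A : E' -> E) (L : E' -> E) (f : E -> F) v x :
  (forall h : R, A (h *: v + x) = h *: L v + A x) ->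
  'D_v (f \o A) x = 'D_(L v) f (A x).
Proof.
move=> HA; rewrite /derive /=.
set g := fun h : R => h^-1 *: _; set g' := fun h : R => h^-1 *: _.
suff -> : g = g' by [].
by apply/funext => h; rewrite /g /g' /= HA.
Qed.

Lemma derivable_comp_affine E E' F (A : E' -> E) (L : E' -> E) (f : E -> F) v x :
  (forall h : R, A (h *: v + x) = h *: L v + A x) ->
  derivable f (A x) (L v) -> derivable (f \o A) x v.
Proof.
move=> HA; rewrite /derivable /=.
set g := fun h : R => h^-1 *: _; set g' := fun h : R => h^-1 *: _.
suff -> : g' = g by [].
by apply/funext => h; rewrite /g /g' /= HA.
Qed.

(** For an affine inner map the direction [L v] does not depend on the point, so the derivative of
    the composite is again a composite with [A] and the induction closes. *)
Lemma Ck_on_comp_affine E E' F k (U : set E) (A : E' -> E) (L : E' -> E)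
    (f : E -> F) :
  (forall (h : R) x v, A (h *: v + x) = h *: L v + A x) ->
  (forall x, differentiable A x) ->
  Ck_on k U f -> Ck_on k (A @^-1` U) (f \o A).
Proof.
move=> HA dA; elim: k f => [|k IH] f /=.
  move=> cf x Ux; apply: continuous_comp; last exact: cf.
  exact: differentiable_continuous.
move=> [df Df]; split=> [x Ux|v].
  by apply: differentiable_comp => //; exact: df.
rewrite (_ : (fun x => _) = (fun x => 'D_(L v) f x) \o A); first exact: IH.
by apply/funext => x; rewrite (derive_comp_affine _ (L := L)).
Qed.

Lemma derive_lin E F H (l : {linear F -> H}) (f : E -> F) v x :
  continuous l -> derivable f x v -> is_derive x v (l \o f) (l ('D_v f x)).
Proof.
move=> cl df; have hc : (fun h : R => h^-1 *: ((l \o f) (h *: v + x) - (l \o f) x))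
    @ 0^' --> l ('D_v f x).
  rewrite (_ : (fun h : R => _) =
    l \o (fun h : R => h^-1 *: (f (h *: v + x) - f x))); last first.
    by apply/funext => h; rewrite [RHS]/comp linearZ -linearB.
  by apply: continuous_cvg; [exact: cl|exact: df].
apply: DeriveDef; last exact: cvg_lim.
by apply/cvg_ex; eexists; exact: hc.
Qed.

Lemma Ck_on_lin E F H k (U : set E) (l : {linear F -> H}) (f : E -> F) :
  open U -> continuous l -> Ck_on k U f -> Ck_on k U (l \o f).
Proof.
move=> oU cl; elim: k f => [|k IH] f /=.
  by move=> cf x Ux; apply: continuous_comp; [exact: cf|exact: cl].
move=> [df Df]; split=> [x Ux|v].
  apply: differentiable_comp; first exact: df.
  exact: linear_differentiable.
apply: eq_Ck_on (IH _ (Df v)) => // x Ux /=.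
by have [_ ->] := derive_lin (v := v) cl (diff_derivable (df x Ux)).
Qed.

Lemma smooth_on_derive E F (U : set E) (f : E -> F) v :
  smooth_on U f -> smooth_on U ('D_v f).
Proof. by move=> Sf k; have [_ Df] := Sf k.+1; exact: Df. Qed.

Lemma smooth_on_differentiable E F (U : set E) (f : E -> F) x :
  smooth_on U f -> U x -> differentiable f x.
Proof. by move=> Sf; have [df _] := Sf 1%N; exact: df. Qed.

End Ck.

(** * Row-valued functions, coordinate by coordinate *)

Section Coordinates.
Context {R : realType}.
Implicit Types E F : normedModType R.

Lemma coord_norm_le n (v : 'rV[R]_n) i : `|v 0 i| <= `|v|.
Proof.
by rewrite [leRHS]/Num.Def.normr/= mx_normrE; exact: (le_bigmax _ _ (0, i)).
Qed.

Lemma rV_norm_le n (v : 'rV[R]_n) (K : R) :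
  0 <= K -> (forall i, `|v 0 i| <= K) -> `|v| <= K.
Proof.
move=> K0 H; rewrite [leLHS]/Num.Def.normr/= mx_normrE (bigmax_le _ K0)//.
by case=> i j _ /=; rewrite ord1.
Qed.

Lemma derivable_coord E n (f : E -> 'rV[R]_n) x v i :
  derivable f x v -> derivable (fun y => f y 0 i : R^o) x v.
Proof. by move/derivable_mxP. Qed.

Lemma derive_coord E n (f : E -> 'rV[R]_n) x v i :
  derivable f x v -> 'D_v (fun y => f y 0 i : R^o) x = ('D_v f x) 0 i.
Proof. by move=> df; rewrite derive_mx // mxE. Qed.

Lemma differentiable_coord_comp E n (f : E -> 'rV[R]_n) x i :
  differentiable f x -> differentiable (fun y => f y 0 i : R^o) x.
Proof.
move=> df; apply: (@differentiable_comp _ E _ R^o f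
  (fun M : 'rV[R]_n => M 0 i : R^o)) => //.
exact: differentiable_coord.
Qed.

Lemma Ck_on_coord E n k (U : set E) (f : E -> 'rV[R]_n) i :
  open U -> Ck_on k U f -> Ck_on k U (fun x => f x 0 i : R^o).
Proof.
move=> oU; elim: k f => [|k IH] f /=.
  move=> cf x Ux; apply: (@continuous_comp _ _ _ f
    (fun M : 'rV[R]_n => M 0 i : R^o)); first exact: cf.
  exact: coord_continuous.
move=> [df Df]; split=> [x Ux|v].
  by apply: differentiable_coord_comp; exact: df.
apply: eq_Ck_on (IH _ (Df v)) => // x Ux /=.
by rewrite derive_coord //; apply: diff_derivable; exact: df.
Qed.

Lemma Ck_on_scalel E F k (U : set E) (f : E -> R^o) (a : F) :
  open U -> Ck_on k U f -> Ck_on k U (fun x => f x *: a).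
Proof.
move=> oU Hf; have lin_scal : linear (fun h : R^o => h *: a).
  by move=> ? ? ?; rewrite /= scalerDl scalerA.
pose scallM := GRing.isLinear.Build _ _ _ _ _ lin_scal.
pose scalL : {linear R^o -> F} := HB.pack (fun h : R^o => h *: a) scallM.
by apply: (@Ck_on_lin _ E _ F k U scalL f) => //; exact: scalel_continuous.
Qed.

Lemma Ck_on_row E n k (U : set E) (f : E -> 'rV[R]_n) :
  open U -> (forall i, Ck_on k U (fun x => f x 0 i : R^o)) -> Ck_on k U f.
Proof.
move=> oU H; rewrite (_ : f =
    \sum_(i < n) (fun x => (f x 0 i : R^o) *: (delta_mx 0 i : 'rV[R]_n))).
  by apply: Ck_on_sum => // i; exact: Ck_on_scalel.
by apply/funext => x; rewrite fct_sumE [LHS]row_sum_delta.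
Qed.

Lemma derive_sum_basis n F (f : 'rV[R]_n -> F) x v : differentiable f x ->
  'D_v f x = \sum_i v 0 i *: 'D_(delta_mx 0 i) f x.
Proof.
move=> df; rewrite deriveE // {1}(row_sum_delta v) linear_sum.
by apply: eq_bigr => i _; rewrite linearZ deriveE.
Qed.

End Coordinates.

(** * Derivatives along curves and mean value inequalities *)

Section Curves.
Context {R : realType}.
Implicit Types E F : normedModType R.

Lemma is_derive_curve E F (f : E -> F) (u : R^o -> E) (t : R^o) (u' : E) :
  differentiable f (u t) -> is_derive t (1 : R^o) u u' ->
  is_derive t (1 : R^o) (f \o u) ('D_u' f (u t)).
Proof.
move=> df [du <-]; have du' : differentiable u t by exact/derivable1_diffP.
have dfu : differentiable (f \o u) t by exact: differentiable_comp.
apply: DeriveDef; first exact: diff_derivable.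
by rewrite deriveE // diff_comp //= deriveE // deriveE.
Qed.

Lemma is_derive_line E F (f : E -> F) x v (t : R^o) :
  derivable f (t *: v + x) v ->
  is_derive t (1 : R^o) (fun s : R^o => f (s *: v + x)) ('D_v f (t *: v + x)).
Proof.
have HA (h : R) : (h *: (1 : R^o) + t) *: v + x = h *: v + (t *: v + x).
  by rewrite scalerDl addrA [_%:A]mulr1.
move=> df; apply: DeriveDef.
  exact: (derivable_comp_affine (A := fun s : R^o => s *: v + x)
    (L := fun _ : R^o => v)).
exact: (derive_comp_affine (A := fun s : R^o => s *: v + x)
  (L := fun _ : R^o => v)).
Qed.

Lemma MVT_line E (f : E -> R^o) x v (s : R) : 0 < s ->
  (forall t, t \in `[0, s] -> differentiable f (t *: v + x)) ->
  exists2 t, t \in `]0, s[ & f (s *: v + x) - f x = s * 'D_v f (t *: v + x).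
Proof.
move=> s0 df.
have der t : t \in `[0, s] -> is_derive (t : R^o) (1 : R^o)
    (fun s : R^o => f (s *: v + x)) ('D_v f (t *: v + x)).
  by move=> ts; apply: is_derive_line; apply: diff_derivable; exact: df.
have [|t ts E1] := MVT s0 (fun t ts => der t (subset_itv_oo_cc ts)).
  by apply: derivable_within_continuous => t /der [].
by exists t => //; move: E1; rewrite scale0r add0r subr0 mulrC.
Qed.

(** The norm on rows is the maximum norm, so the scalar mean value theorem applied to each
    coordinate gives the bound with the same [K]. *)
Lemma norm_MVT n (u : R^o -> 'rV[R]_n) (a b K : R) : a <= b ->
  (forall t, t \in `[a, b] -> derivable u t 1 /\ `|'D_1 u t| <= K) ->
  `|u b - u a| <= K * (b - a).
Proof.
move=> ab H; have K0 : 0 <= K.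
  have [|_] := H a; first by rewrite in_itv /= lexx.
  by apply: le_trans.
apply: rV_norm_le => [|i]; first by rewrite mulr_ge0 // subr_ge0.
have der t : t \in `[a, b] ->
    is_derive (t : R^o) (1 : R^o) (fun s : R^o => u s 0 i : R^o) ('D_1 u t 0 i).
  move=> /H [du _]; apply: DeriveDef; first exact: derivable_coord.
  by rewrite derive_coord.
have [|t ts E1] := MVT_segment ab (fun t ts => der t (subset_itv_oo_cc ts)).
  by apply: derivable_within_continuous => t /der [].
rewrite !mxE E1 normrM (ger0_norm (_ : 0 <= b - a)) ?subr_ge0 //.
rewrite ler_wpM2r ?subr_ge0 //; apply: le_trans (coord_norm_le _ _) _.
by have [] := H t ts.
Qed.

End Curves.

Local Opaque derive diff.

Section CurvesAndPairs.
Context {R : realType}.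

Lemma is_derive_shift0 (F : normedModType R) (g : R^o -> F) (t : R^o) a :
  is_derive (0 : R^o) (1 : R^o) (fun s => g (s + t)) a ->
  is_derive t (1 : R^o) g a.
Proof.
move=> [d e]; pose f s := g (s + t).
have tt : t - t = 0 by rewrite subrr.
pose sh (r : R^o) : R^o := r - t.
have dt : is_derive t (1 : R^o) sh 1.
  exact: (is_derive_shift t (1 : R) (- t)).
have df : differentiable f (t - t) by rewrite tt; apply/derivable1_diffP.
have := @is_derive_curve _ _ _ f sh t 1 df dt; rewrite /sh tt e.
by rewrite (_ : f \o _ = g) //; apply/funext => s; rewrite /f /= subrK.
Qed.

Lemma is_derive_shifted (F : normedModType R) (g : R^o -> F) (q s : R^o) a :
  is_derive (q + s) (1 : R^o) g a ->
  is_derive q (1 : R^o) (fun q => g (q + s)) a.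
Proof.
move=> [d <-]; pose sh (r : R^o) : R^o := r + s.
have dt : is_derive q (1 : R^o) sh 1 by exact: is_derive_shift.
have df : differentiable g (sh q) by apply/derivable1_diffP.
exact: @is_derive_curve _ _ _ g sh q 1 df dt.
Qed.

Lemma derive_real_direction (F : normedModType R) (f : R^o -> F) (x a : R^o) :
  differentiable f x -> 'D_a f x = a *: 'D_(1 : R^o) f x.
Proof. by move=> df; rewrite !deriveE // -linearZ /= [a *: _]mulr1. Qed.

Lemma pairl_differentiable (E1 E2 : normedModType R) (q : E2) (p : E1) :
  differentiable (fun p : E1 => (p, q)) p.
Proof. by apply: differentiable_pair. Qed.

Lemma pairr_differentiable (E1 E2 : normedModType R) (p : E1) (q : E2) :
  differentiable (fun q : E2 => (p, q)) q.
Proof. by apply: differentiable_pair. Qed.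

Lemma pairl_affine (E1 E2 : normedModType R) (q : E2) (v p : E1) (h : R) :
  (h *: v + p, q) = h *: (v, 0 : E2) + (p, q).
Proof. by apply: injective_projections; rewrite /= ?scaler0 ?add0r. Qed.

Lemma pairr_affine (E1 E2 : normedModType R) (p : E1) (v q : E2) (h : R) :
  (p, h *: v + q) = h *: (0 : E1, v) + (p, q).
Proof. by apply: injective_projections; rewrite /= ?scaler0 ?add0r. Qed.

Lemma is_derive_pair (F H : normedModType R) (g : R^o -> F) (h : R^o -> H)
    (t : R^o) a b :
  is_derive t (1 : R^o) g a -> is_derive t (1 : R^o) h b ->
  is_derive t (1 : R^o) (fun s => (g s, h s)) (a, b).
Proof.
move=> [dg <-] [dh <-].
have dg' : differentiable g t by apply/derivable1_diffP.
have dh' : differentiable h t by apply/derivable1_diffP.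
have dp := differentiable_pair dg' dh'.
apply: DeriveDef; first exact: diff_derivable.
by rewrite !deriveE // diff_pair.
Qed.

Lemma is_derive_dot m (a b : 'I_m -> R^o -> R^o) (t : R^o) (a' b' : 'I_m -> R) :
  (forall j, is_derive t (1 : R^o) (a j) (a' j)) ->
  (forall j, is_derive t (1 : R^o) (b j) (b' j)) ->
  is_derive t (1 : R^o) (fun s => \sum_j a j s * b j s : R^o)
    (\sum_j (a' j * b j t + a j t * b' j)).
Proof.
move=> da db; rewrite (_ : (fun s => _) = \sum_j (a j * b j)); last first.
  by apply/funext => s; rewrite fct_sumE.
apply: is_derive_sum => j; apply: is_derive_eq (is_deriveM (da j) (db j)) _.
by rewrite addrC [b j t *: _]mulrC.
Qed.

Lemma is_derive_near_cst (F : normedModType R) (g : R^o -> F) (t : R^o) (a c : F) :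
  (\forall s \near t, g s = c) -> is_derive t (1 : R^o) g a -> a = 0.
Proof.
move=> gc dg; have [_ <-] := near_eq_is_derive gc dg.
exact: derive_cst.
Qed.

Lemma is_derive_unique (F : normedModType R) (g : R^o -> F) (t : R^o) (a b : F) :
  is_derive t (1 : R^o) g a -> is_derive t (1 : R^o) g b -> a = b.
Proof. by move=> [_ <-] [_ <-]. Qed.

Lemma derive_graph (E F H : normedModType R) (V : E -> F) (S : E * F -> H) p w :
  differentiable V p -> differentiable S (p, V p) ->
  'D_w (fun p => S (p, V p)) p = 'D_(w, 'D_w V p) S (p, V p).
Proof.
move=> dV dS; have did : differentiable (id : E -> E) p by [].
have dp := differentiable_pair did dV.
rewrite deriveE; last exact: (differentiable_comp dp dS).
rewrite (diff_comp dp dS) /= diff_pair //= diff_val (deriveE w dV).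
by rewrite deriveE.
Qed.

Lemma derive_pair_split (E F H : normedModType R) (S : E * F -> H) z a b :
  differentiable S z -> 'D_(a, b) S z = 'D_(a, 0) S z + 'D_(0, b) S z.
Proof.
move=> dS; rewrite !deriveE // -linearD; congr ('d S z _).
by apply: injective_projections; rewrite /= ?addr0 ?add0r.
Qed.

End CurvesAndPairs.

(** * Symmetry of second derivatives *)

Section Schwarz.
Context {R : realType} {E : normedModType R}.

(** Two mean value theorems: one along [v] for the increment [g y = f (s *: w + y) - f y], one along
    [w] for ['D_v f]. *)
Lemma second_difference (f : E -> R^o) (U : set E) x v w (s : R) : 0 < s ->
  Ck_on 2 U f ->
  (forall a b, a \in `[0, s] -> b \in `[0, s] -> U (a *: v + (b *: w + x))) ->
  exists a b, [/\ a \in `[0, s], b \in `[0, s] &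
    f (s *: v + (s *: w + x)) - f (s *: v + x) - (f (s *: w + x) - f x) =
    s ^+ 2 * 'D_w ('D_v f) (a *: v + (b *: w + x))].
Proof.
move=> s0 [df Df] HU.
have s0s : s \in `[0, s] by rewrite in_itv /= lexx ltW.
have z0s : 0 \in `[0, s] by rewrite in_itv /= lexx ltW.
pose g y := f (s *: w + y) - f y.
have dsh y : U (s *: w + y) -> is_diff y (fun y => f (s *: w + y))
    ('d f (s *: w + y)).
  move=> Uy; have sh : is_diff y (fun y => s *: w + y) id.
    by apply: is_diff_eq; rewrite add0r.
  have dfy : is_diff (s *: w + y) f ('d f (s *: w + y)).
    by apply/differentiableP; exact: df.
  exact: (@is_diff_comp _ _ _ _ (fun y => s *: w + y) id f _ y).
have [|a as_ Ea] := @MVT_line R E g x v s s0.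
  move=> t ts; apply: differentiableB.
    by have [] := dsh (t *: v + x) _; first by rewrite addrCA; exact: HU.
  by apply: df; move: (HU t 0 ts z0s); rewrite scale0r add0r.
have as' := subset_itv_oo_cc as_.
have [|b bs Eb] := @MVT_line R E ('D_v f) (a *: v + x) w s s0.
  move=> t ts; have [dDf _] := Df v; apply: dDf.
  by rewrite addrCA; exact: HU.
have bs' := subset_itv_oo_cc bs.
exists a, b; split; [exact: as'|exact: bs'|].
have -> : f (s *: v + (s *: w + x)) - f (s *: v + x) - (f (s *: w + x) - f x) =
    g (s *: v + x) - g x by rewrite /g addrCA.
rewrite Ea expr2 -mulrA; congr (_ * _); rewrite addrCA -Eb.
have Uy : U (s *: w + (a *: v + x)) by rewrite addrCA; exact: HU.
have Uy' : U (a *: v + x).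
  by move: (HU a 0 as' z0s); rewrite scale0r add0r.
have [d1 e1] := dsh _ Uy.
rewrite deriveB; [|exact: diff_derivable|by apply: diff_derivable; exact: df].
by rewrite deriveE // e1 -deriveE //; exact: df.
Qed.

(* The second difference is symmetric in [v] and [w]. *)
Lemma derive_symmetric (f : E -> R^o) (U : set E) x v w :
  open U -> Ck_on 2 U f -> U x -> 'D_v ('D_w f) x = 'D_w ('D_v f) x.
Proof.
move=> oU Hf Ux; apply/eqP; rewrite -subr_eq0 -normr_le0.
apply/ler_addgt0Pl => e e0; rewrite addr0.
have [_ Df] := Hf.
have cont a b : {for x, continuous ('D_a ('D_b f))}.
  have [_ Dfb] := Df b; move: (Dfb a) => /= c; exact: c.
have near_x : \forall y \near x, [/\ U y,
   `|'D_v ('D_w f) x - 'D_v ('D_w f) y| < e / 2 &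
   `|'D_w ('D_v f) x - 'D_w ('D_v f) y| < e / 2].
  have e2 : 0 < e / 2 by rewrite divr_gt0.
  have n1 : \forall y \near x, U y by exact: open_nbhs_nbhs.
  have n2 := (cvgrPdist_lt _ _).1 (cont v w) _ e2.
  have n3 := (cvgrPdist_lt _ _).1 (cont w v) _ e2.
  by apply: filterS3 n1 (n2 _) (n3 _) => y h1 h2 h3; split; [exact: h1|exact: h2|exact: h3].
have /nbhs_ballP[d /= d0 Hd] := near_x.
(* Small enough for the whole parallelogram with sides [s *: v] and [s *: w] to stay in the ball;
   the 1 keeps the denominator positive when both directions vanish. *)
pose s := d / 2 / (`|v| + `|w| + 1).
have N1 : 0 < `|v| + `|w| + 1 by rewrite ltr_wpDl // addr_ge0.
have s0 : 0 < s by rewrite !divr_gt0.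
have inball a b : a \in `[0, s] -> b \in `[0, s] -> ball x d (a *: v + (b *: w + x)).
  rewrite !in_itv /= => /andP[a0 as_] /andP[b0 bs].
  rewrite -ball_normE /= -normrN opprB addrA addrK.
  apply: le_lt_trans (ler_normD _ _) _; rewrite !normrZ !ger0_norm //.
  have dd : d / 2 < d by rewrite ltr_pdivrMr // ltr_pMr // ltr1n.
  apply: le_lt_trans dd; rewrite -[leRHS](divfK (lt0r_neq0 N1)) -/s.
  rewrite !mulrDr mulr1; apply: ler_wpDr; first exact: ltW.
  by apply: lerD; apply: ler_wpM2r.
have HU1 a b : a \in `[0, s] -> b \in `[0, s] -> U (a *: v + (b *: w + x)).
  by move=> ha hb; have [] := Hd _ (inball _ _ ha hb).
have [a [b [ha hb E1]]] := second_difference s0 Hf HU1.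
have [|b' [a' [hb' ha' E2]]] := @second_difference f U x w v s s0 Hf.
  by move=> b' a' hb' ha'; rewrite addrCA; exact: HU1.
have EE : 'D_w ('D_v f) (a *: v + (b *: w + x)) =
    'D_v ('D_w f) (a' *: v + (b' *: w + x)).
  have s20 : s ^+ 2 != 0 by rewrite expf_neq0 // lt0r_neq0.
  have alg (p q r t : R) : p - q - (r - t) = p - r - (q - t) by ring.
  rewrite (addrCA (b' *: w)) (addrCA (s *: w)) in E2.
  apply: (mulfI s20); apply: etrans (esym E1) _.
  by apply: etrans (alg _ _ _ _) _; exact: E2.
have [_ H1 _] := Hd _ (inball _ _ ha' hb').
have [_ _ H2] := Hd _ (inball _ _ ha hb).
rewrite EE distrC in H2; rewrite (splitr e).
exact: le_trans (ler_distD _ _ _) (lerD (ltW H1) (ltW H2)).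
Qed.

Lemma derive_symmetric_row n (f : E -> 'rV[R]_n) (U : set E) x v w :
  open U -> Ck_on 2 U f -> U x -> 'D_v ('D_w f) x = 'D_w ('D_v f) x.
Proof.
move=> oU Hf Ux; have [df Df] := Hf.
have nU : \forall y \near x, U y by exact: open_nbhs_nbhs.
have E1 a b i : 'D_a ('D_b (fun y => f y 0 i : R^o)) x = ('D_a ('D_b f) x) 0 i.
  have [dDf _] := Df b.
  rewrite -derive_coord; last by apply: diff_derivable; exact: dDf.
  apply: near_eq_derive; apply: filterS nU => y Uy.
  by rewrite derive_coord //; apply: diff_derivable; exact: df.
apply/rowP => i; apply: etrans (esym (E1 v w i)) _.
apply: etrans (E1 w v i).
exact: (derive_symmetric v w oU (Ck_on_coord i oU Hf) Ux).
Qed.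

End Schwarz.

(** * Local Lipschitz bounds for C^1 fields *)

Section Lipschitz.
Context {R : realType} {n : nat}.
Local Notation E := 'rV[R]_n.

(** By continuity each partial derivative is bounded near [e] by its norm at [e] plus 1. Balls are
    convex, so the mean value inequality on the segment from [q] to [p] applies, with the sum of
    these bounds as constant. *)
Lemma C1_lipschitz (V : E -> E) (U : set E) (e : E) :
  open U -> Ck_on 1 U V -> U e ->
  exists r L : R, [/\ 0 < r, 0 <= L,
    forall p, `|p - e| <= r -> U p &
    forall p q, `|p - e| <= r -> `|q - e| <= r ->
      `|V p - V q| <= L * `|p - q|].
Proof.
move=> oU [dV DV] Ue.
pose C i : R := `|'D_(delta_mx 0 i) V e| + 1.
have nU : \forall y \near e, U y by exact: open_nbhs_nbhs.
have nC : \forall y \near e, forall i : 'I_n, `|'D_(delta_mx 0 i) V y| <= C i.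
  have near_i i : \forall y \near e, `|'D_(delta_mx 0 i) V y| <= C i; last first.
    exact: filter_forall near_i.
  have c := DV (delta_mx 0 i) e Ue.
  have near_c := (cvgrPdist_le _ _).1 c 1 ltr01.
  apply: filterS (near_c _) => y Hy; rewrite /C -lerBlDl.
  by apply: le_trans (lerB_dist _ _) _; rewrite distrC.
have nUC : \forall y \near e, U y /\
    forall i : 'I_n, `|'D_(delta_mx 0 i) V y| <= C i by exact: filterI nU nC.
have /nbhs_ballP[d /= d0 Hd] := nUC.
have r0 : 0 < d / 2 by rewrite divr_gt0.
have inb p : `|p - e| <= d / 2 -> ball e d p.
  rewrite -ball_normE /= distrC => H; apply: le_lt_trans H _.
  by rewrite ltr_pdivrMr // ltr_pMr // ltr1n.
exists (d / 2), (\sum_i C i); split => //.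
- by apply: sumr_ge0 => i _; rewrite addr_ge0.
- by move=> p /inb /Hd [].
move=> p q Hp Hq.
have inseg (t : R) : t \in `[0, 1] -> ball e d (t *: (p - q) + q).
  rewrite in_itv /= => /andP[t0 t1]; apply: inb.
  have -> : t *: (p - q) + q - e = t *: (p - e) + (1 - t) *: (q - e).
    by apply/rowP => i; rewrite !mxE; ring.
  apply: le_trans (ler_normD _ _) _; rewrite !normrZ (ger0_norm t0).
  rewrite (ger0_norm (_ : 0 <= 1 - t)) ?subr_ge0 //.
  have h1 : t * `|p - e| <= t * (d / 2) by apply: ler_wpM2l.
  have h2 : (1 - t) * `|q - e| <= (1 - t) * (d / 2).
    by apply: ler_wpM2l; rewrite ?subr_ge0.
  by lra.
have := @norm_MVT R n (fun t : R^o => V (t *: (p - q) + q)) 0 1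
  ((\sum_i C i) * `|p - q|) ler01.
rewrite scale1r subrK scale0r add0r subr0 mulr1; apply => t /inseg /Hd [Ut Ct].
have dVt := dV _ Ut.
have [d1 ->] := is_derive_line (diff_derivable (v := p - q) dVt); split => //.
rewrite derive_sum_basis //; apply: le_trans (ler_norm_sum _ _ _) _.
rewrite mulr_suml; apply: ler_sum => i _; rewrite normrZ mulrC.
by apply: ler_pM => //; exact: coord_norm_le.
Qed.

End Lipschitz.

(** * Ordinary differential equations *)

Section Geometric.
Context {R : realType}.

(** This stands in for passing to the limit: the convergence arguments below carry explicit rates
    2^-k and end with this Archimedean step. *)
Lemma le_geometric0 (x C : R) : (forall k, x <= C / 2 ^+ k) -> x <= 0.
Proof.
move=> H; rewrite leNgt; apply/negP => x0.
have C0 : 0 < C by move: (H 0%N); rewrite expr0 divr1; exact: lt_le_trans.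
pose k := Num.truncn (C / x).
have := H k.+1; rewrite ler_pdivlMr ?exprn_gt0 // mulrC -ler_pdivlMr //.
apply/negP; rewrite -ltNge; apply: lt_trans (truncnS_gt _) _.
by rewrite -natrX ltr_nat ltn_expl.
Qed.

(** The radius [c k] is the sum of the geometric tail, so the intervals of radius [c k] about [x k]
    are nested; the supremum of their left ends lies in all of them. *)
Lemma geometric_limit (x : nat -> R) (C : R) :
  (forall k, `|x k.+1 - x k| <= C / 2 ^+ k) ->
  exists l, forall k, `|x k - l| <= 2 * C / 2 ^+ k.
Proof.
move=> H.
pose c k : R := 2 * C / 2 ^+ k.
have cS k : c k.+1 = C / 2 ^+ k.
  by rewrite /c exprS invfM mulrACA divff ?pnatr_eq0 // mul1r.
have cE k : c k = C / 2 ^+ k + C / 2 ^+ k by rewrite /c -mulrA mulr2n mulrDl mul1r.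
have c0 k : 0 <= c k.
  by rewrite cE; have := le_trans (normr_ge0 _) (H k) => ?; exact: addr_ge0.
have Hd k : x k - c k <= x k.+1 - c k.+1.
  by move: (H k); rewrite ler_norml cS cE => /andP[? _]; lra.
have Hi k : x k.+1 + c k.+1 <= x k + c k.
  by move: (H k); rewrite ler_norml cS cE => /andP[_ ?]; lra.
have Hd' k m : x k - c k <= x (k + m)%N - c (k + m)%N.
  elim: m => [|m IH]; first by rewrite addn0.
  by rewrite addnS; exact: le_trans IH (Hd _).
have Hi' k m : x (k + m)%N + c (k + m)%N <= x k + c k.
  elim: m => [|m IH]; first by rewrite addn0.
  by rewrite addnS; exact: le_trans (Hi _) IH.
have ab k m : x k - c k <= x m + c m.
  apply: le_trans (Hd' k m) _; rewrite addnC; apply: le_trans (Hi' m k).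
  by have := c0 (m + k)%N => ?; lra.
pose A := range (fun k => x k - c k).
have A0 : A !=set0 by exists (x 0%N - c 0%N); exists 0%N.
have ubA k : ubound A (x k + c k) by move=> _ [m _ <-]; exact: ab.
have hA : has_sup A by split => //; exists (x 0%N + c 0%N); exact: ubA.
exists (sup A) => k; rewrite ler_distlC; apply/andP; split.
  by apply: ub_le_sup; [case: hA|exists k].
by apply: ge_sup => //; exact: ubA.
Qed.

Lemma geometric_limit_row n (x : nat -> 'rV[R]_n) (C : R) :
  (forall k, `|x k.+1 - x k| <= C / 2 ^+ k) ->
  exists l, forall k, `|x k - l| <= 2 * C / 2 ^+ k.
Proof.
move=> H.
have C0 : 0 <= C by have := le_trans (normr_ge0 _) (H 0%N); rewrite expr0 divr1.
have Hi i : exists l, forall k, `|x k 0 i - l| <= 2 * C / 2 ^+ k.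
  apply: geometric_limit => k; apply: le_trans (H k).
  by have := coord_norm_le (x k.+1 - x k) i; rewrite !mxE.
have [l Hl] := boolp.choice Hi; exists (\row_i l i) => k.
apply: rV_norm_le => [|i]; first by rewrite divr_ge0 ?mulr_ge0 ?exprn_ge0.
by rewrite !mxE; exact: Hl.
Qed.

End Geometric.

Section Clamp.
Context {R : realType}.

(** The retraction of the line onto [-d, d]. Precomposition with it turns a function known only on
    that interval into one continuous everywhere, as [antiderivative] asks. *)
Definition clamp (d t : R) : R := Num.max (- d) (Num.min d t).

Lemma clamp_norm d t : 0 <= d -> `|clamp d t| <= d.
Proof.
move=> d0; rewrite ler_norml /clamp le_max lexx /= ge_max ge_min lexx /= andbT.
by lra.
Qed.

Lemma clamp_id d t : `|t| <= d -> clamp d t = t.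
Proof.
rewrite ler_norml => /andP[td1 td2]; rewrite /clamp.
by rewrite (min_idPr td2) (max_idPr td1).
Qed.

Lemma clamp_lipschitz d s t : `|clamp d s - clamp d t| <= `|s - t|.
Proof.
rewrite /clamp /Num.max /Num.min.
have [h1|h1] := ltP d s; have [h2|h2] := ltP d t;
  do ?case: ifPn => ?; rewrite ?subrr ?normr0 ?normr_ge0 //;
  rewrite ler_norml; apply/andP; split;
  by have := ler_norm (s - t); have := ler_norm (- (s - t)); rewrite normrN; lra.
Qed.

End Clamp.

Section Antiderivative.
Context {R : realType}.

Lemma antiderivative_real (g : R^o -> R^o) (d a : R) : 0 < d ->
  (forall t, {for t, continuous g}) ->
  exists2 H : R^o -> R^o, H 0 = a &
    forall t : R^o, `|t| <= d -> is_derive t (1 : R^o) H (g t).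
Proof.
move=> d0 cg; pose mu := @lebesgue_measure R.
(* Integration runs over an interval larger by 1 on each side, so that every [t] with [|t| <= d] is
   interior and the derivative there is two-sided. *)
pose b : R := - (d + 1).
pose H0 x : R := (\int[mu]_(t in [set` `[b, x]]) (g t))%R.
have dH t : `|t| <= d -> is_derive (t : R^o) (1 : R^o) (H0 : R^o -> R^o) (g t).
  rewrite ler_norml => /andP[t1 t2].
  have tu : t < d + 1 by lra.
  have bt : b < t by rewrite /b; lra.
  have ig : mu.-integrable `[b, d + 1] (EFin \o g).
    apply: continuous_compact_integrable; first exact: segment_compact.
    by apply: continuous_subspaceT => x; exact: cg.
  have [D1 D2] := continuous_FTC1_closed tu ig bt (cg t).
  apply: DeriveDef; first exact: D1.
  by rewrite -derive1E; exact: D2.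
exists (fun t => H0 t - H0 0 + a); first by rewrite subrr add0r.
move=> t /dH dHt.
apply: (is_derive_eq (f' := g t - 0 + 0)).
by rewrite subr0 addr0.
Qed.

Lemma antiderivative n (g : R^o -> 'rV[R]_n) (d : R) (a : 'rV[R]_n) : 0 < d ->
  (forall t, {for t, continuous g}) ->
  exists2 H : R^o -> 'rV[R]_n, H 0 = a &
    forall t : R^o, `|t| <= d -> is_derive t (1 : R^o) H (g t).
Proof.
move=> d0 cg.
have Hi i : exists H : R^o -> R^o, H 0 = a 0 i /\
    forall t : R^o, `|t| <= d -> is_derive t (1 : R^o) H (g t 0 i : R^o).
  have [|H h1 h2] := @antiderivative_real (fun t => g t 0 i : R^o) d (a 0 i) d0.
    move=> t; apply: (@continuous_comp _ _ _ g
      (fun M : 'rV[R]_n => M 0 i : R^o)); first exact: cg.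
    exact: coord_continuous.
  by exists H.
have [H HH] := boolp.choice Hi.
exists (fun t => \row_i H i t).
  by apply/rowP => i; rewrite mxE; have [-> _] := HH i.
move=> t td.
have dH : derivable (fun t : R^o => \row_i H i t) t 1.
  apply/derivable_mxP => i j; rewrite ord1.
  rewrite (_ : (fun x => _) = H j); first by have [_ /(_ t td) []] := HH j.
  by apply/funext => x; rewrite mxE.
apply: DeriveDef => //; apply/rowP => j.
rewrite -(derive_coord j dH).
rewrite (_ : (fun x => _) = H j); first by have [_ /(_ t td) []] := HH j.
by apply/funext => x; rewrite mxE.
Qed.

End Antiderivative.

Section ODE.
Context {R : realType} {n : nat}.
Local Notation E := 'rV[R]_n.

Lemma lipschitz_continuous (F H : normedModType R) (f : F -> H) (L : R) :
  (forall p q, `|f p - f q| <= L * `|p - q|) -> forall p, {for p, continuous f}.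
Proof.
move=> Hf p; apply/cvgrPdist_lt => e e0.
have L1 : 0 < `|L| + 1 by rewrite ltr_wpDl.
have : \forall q \near p, `|p - q| < e / (`|L| + 1).
  by apply: (cvgrPdist_lt _ _).1 => //; rewrite divr_gt0.
apply: filterS => q; rewrite ltr_pdivlMr // mulrC; apply: le_lt_trans.
apply: le_trans (Hf p q) _; apply: ler_wpM2r => //.
by apply: le_trans (ler_norm _) _; rewrite lerDl.
Qed.

Lemma norm_MVT0 (u : R^o -> E) (d K : R) :
  (forall t, `|t| <= d -> derivable u t 1 /\ `|'D_1 u t| <= K) ->
  forall t, `|t| <= d -> `|u t - u 0| <= K * `|t|.
Proof.
move=> H t td; have [t0|t0] := leP 0 t.
  have := @norm_MVT R n u 0 t K t0; rewrite subr0 => HM.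
  rewrite (ger0_norm t0); apply: HM => s.
  rewrite in_itv /= => /andP[s0 st]; apply: H.
  by rewrite (ger0_norm s0); apply: le_trans st _; rewrite -(ger0_norm t0).
have := @norm_MVT R n u t 0 K (ltW t0); rewrite sub0r => HM.
rewrite distrC (ltr0_norm t0); apply: HM => s.
rewrite in_itv /= => /andP[ts s0]; apply: H.
by rewrite (ler0_norm s0); apply: le_trans td; rewrite (ltr0_norm t0) lerN2.
Qed.

Lemma is_derive_sub (F : normedModType R) (u v : R^o -> F) (t : R^o) a b :
  is_derive t (1 : R^o) u a -> is_derive t (1 : R^o) v b ->
  is_derive t (1 : R^o) (fun s => u s - v s) (a - b).
Proof. by move=> hu hv; exact: is_deriveB. Qed.

Lemma picard (W : E -> E) (L : R) (a : E) : 0 <= L ->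
  (forall p q, `|W p - W q| <= L * `|p - q|) ->
  exists (d : R) (u : R^o -> E), [/\ 0 < d, u 0 = a &
    forall t : R^o, `|t| <= d -> is_derive t (1 : R^o) u (W (u t))].
Proof.
move=> L0 HW; have L1 : 0 < 2 * (L + 1) by rewrite mulr_gt0 // ltr_wpDl.
(* With [L * d <= 1/2] each integration step halves the distance between successive iterates. *)
pose d := (2 * (L + 1))^-1; have d0 : 0 < d by rewrite invr_gt0.
have Ld : L * d <= 2^-1.
  by rewrite /d invfM mulrCA ler_piMr // ler_pdivrMr ?ltr_wpDl // mul1r lerDl.
have cW := lipschitz_continuous HW.
(* Continuity on [-d, d]. Placing it inside the existential of [step] makes integration total, so
   that choice produces an operator [Phi] that can be iterated. *)
pose P (u : R^o -> E) := forall t : R^o, {for t, continuous (u \o clamp d)}.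
have step (u : R^o -> E) : exists H : R^o -> E, P u -> H 0 = a /\
    forall t : R^o, `|t| <= d -> is_derive t (1 : R^o) H (W (u t)).
  have [Pu|nPu] := pselect (P u); last by exists u.
  have cont t : {for t, continuous (W \o (u \o clamp d))}.
    by apply: continuous_comp; [exact: Pu|exact: cW].
  have [H h1 h2] := antiderivative a d0 cont; exists H => _; split => // t td.
  by have := h2 t td; rewrite /= clamp_id.
have [Phi HPhi] := boolp.choice step.
have clamp_cont (t : R^o) : {for t, continuous (clamp d : R^o -> R^o)}.
  apply: (@lipschitz_continuous R^o R^o _ 1) => p q; rewrite mul1r.
  exact: clamp_lipschitz.
pose u k := iter k Phi (cst a).
have Pder (v : R^o -> E) : (forall t : R^o, `|t| <= d -> derivable v t 1) -> P v.
  move=> dv t; apply: continuous_comp; first exact: clamp_cont.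
  by apply/differentiable_continuous/derivable1_diffP/dv/clamp_norm/ltW.
have Pu k : P (u k).
  elim: k => [|k IH]; first by move=> t; exact: cvg_cst.
  by apply: Pder => t td; have [_ /(_ t td) []] := HPhi (u k) IH.
have u0 k : u k 0 = a.
  by case: k => [//|k]; have [] := HPhi (u k) (Pu k).
have du k (t : R^o) : `|t| <= d -> is_derive t (1 : R^o) (u k.+1) (W (u k t)).
  by move=> td; have [_ /(_ t td)] := HPhi (u k) (Pu k).
pose C := `|W a| * d.
have C_ge0 : 0 <= C by rewrite mulr_ge0 // ltW.
have dist k t : `|t| <= d -> `|u k.+1 t - u k t| <= C / 2 ^+ k.
  elim: k t => [|k IH] t td.
    rewrite expr0 divr1 (_ : u 0%N t = u 1%N 0); last by rewrite (u0 1%N).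
    have H s : `|s| <= d -> derivable (u 1%N) s 1 /\ `|'D_1 (u 1%N) s| <= `|W a|.
      by move=> sd; have [d1 ->] := du 0%N s sd.
    by apply: le_trans (norm_MVT0 H td) _; apply: ler_wpM2l.
  pose w (s : R^o) : E := u k.+2 s - u k.+1 s.
  have H s : `|s| <= d -> derivable w s 1 /\ `|'D_1 w s| <= L * (C / 2 ^+ k).
    move=> sd; have [d1 e1] := is_derive_sub (du k.+1 s sd) (du k s sd).
    split; first exact: d1.
    rewrite e1; apply: le_trans (HW _ _) _.
    by apply: ler_wpM2l => //; exact: IH.
  have := norm_MVT0 H td; rewrite /w !u0 subrr subr0 => Hw.
  have C0 : 0 <= C / 2 ^+ k by rewrite divr_ge0 ?exprn_ge0 // mulr_ge0 // ltW.
  apply: le_trans Hw _; apply: (@le_trans _ _ (L * (C / 2 ^+ k) * d)).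
    by apply: ler_wpM2l => //; rewrite mulr_ge0.
  rewrite mulrAC (_ : C / 2 ^+ k.+1 = 2^-1 * (C / 2 ^+ k)).
    exact: ler_wpM2r.
  by rewrite exprS invfM mulrCA.
have lim t : exists l, forall k, `|u k (clamp d t) - l| <= 2 * C / 2 ^+ k.
  by apply: geometric_limit_row => k; apply: dist; apply/clamp_norm/ltW.
have [v Hv] := boolp.choice lim.
have cv (t : R^o) : {for t, continuous (v : R^o -> E)}.
  (* Every iterate stays within [4 * C] of [a]: [2 * C] from the iterate to the limit and [2 * C]
     from the limit to the initial constant. This bounds [W] along all iterates, hence their common
     Lipschitz constant. *)
  apply: (@lipschitz_continuous R^o E v (`|W a| + L * (4 * C))) => x y.
  rewrite -subr_le0; apply: (@le_geometric0 _ _ (4 * C)) => k.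
  have bu (s : R) : `|s| <= d -> `|'D_1 (u k.+1) s| <= `|W a| + L * (4 * C).
    move=> sd; have [_ ->] := du k s sd.
    have := HW (u k s) a; have := ler_norm (`|W (u k s)| - `|W a|).
    have := ler_dist_dist (W (u k s)) (W a).
    have := Hv s k; have := Hv s 0%N; rewrite clamp_id // expr0 divr1.
    have hk : 2 * C / 2 ^+ k <= 2 * C.
      rewrite ler_pdivrMr ?exprn_gt0 //; apply: ler_peMr; first by rewrite mulr_ge0.
      by rewrite exprn_ege1 // ler1n.
    have := ler_distD (v s) (u k s) a; rewrite (distrC (v s) a) => h1 h2 h3 h4 h5 h6.
    have h7 : L * `|u k s - a| <= L * (4 * C) by apply: ler_wpM2l => //; lra.
    by lra.
  have lip (p q : R) : `|p| <= d -> `|q| <= d ->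
      `|u k.+1 p - u k.+1 q| <= (`|W a| + L * (4 * C)) * `|p - q|.
    move=> pd qd; wlog pq : p q pd qd / q <= p.
      by move=> wl; have [|/ltW] := leP q p => pq; [|rewrite distrC (distrC p)]; exact: wl.
    rewrite (ger0_norm (_ : 0 <= p - q)) ?subr_ge0 //; apply: norm_MVT => // r.
    rewrite in_itv /= => /andP[r1 r2].
    have rd : `|r| <= d.
      by move: pd qd; rewrite !ler_norml => /andP[? ?] /andP[? ?]; apply/andP; split; lra.
    by split; [have [] := du k r rd|exact: bu].
  have hx := clamp_norm x (ltW d0); have hy := clamp_norm y (ltW d0).
  have h1 := lip _ _ hx hy.
  have K0 : 0 <= `|W a| + L * (4 * C) by apply: addr_ge0 => //; do 2 (apply: mulr_ge0 => //).
  have h2 := ler_wpM2l K0 (clamp_lipschitz d x y).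
  have h3 := Hv x k.+1; have h4 := Hv y k.+1.
  have h5 := ler_distD (u k.+1 (clamp d x)) (v x) (v y).
  have h6 := ler_distD (u k.+1 (clamp d y)) (u k.+1 (clamp d x)) (v y).
  rewrite (distrC (v x) (u _ _)) in h5.
  have h7 : 2 * C / 2 ^+ k.+1 + 2 * C / 2 ^+ k.+1 <= 4 * C / 2 ^+ k.
    rewrite -mulrDl -mulrDl exprS invfM mulrA; apply: ler_wpM2r.
      by rewrite invr_ge0 exprn_ge0.
    by lra.
  by lra.
have cont t : {for t, continuous (W \o (v : R^o -> E))}.
  by apply: continuous_comp; [exact: cv|exact: cW].
(* The limit [v] is not yet known to be differentiable. Integrating [W \o v] gives a differentiable
   [H], which equals [v] because both are within O(2^-k) of the same iterate. *)
have [H H0 dH] := antiderivative a d0 cont.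
exists d, H; split => // t td.
suff Hv' s : `|s| <= d -> H s = v s by rewrite Hv' //; exact: dH.
move=> sd; apply/eqP; rewrite -subr_eq0 -normr_le0.
apply: (@le_geometric0 _ _ (2 * C)) => k.
pose w (s : R^o) : E := u k.+1 s - H s.
have Hw r : `|r| <= d -> derivable w r 1 /\ `|'D_1 w r| <= L * (2 * C / 2 ^+ k).
  move=> rd; have [d1 e1] := is_derive_sub (du k r rd) (dH r rd).
  split; first exact: d1.
  rewrite e1; apply: le_trans (HW _ _) _.
  apply: ler_wpM2l => //; apply: le_trans (Hv r k).
  by rewrite clamp_id.
have := norm_MVT0 Hw sd; rewrite /w u0 H0 subrr subr0 => h1.
have Ck0 : 0 <= C / 2 ^+ k by rewrite divr_ge0 ?exprn_ge0.
have h2 : L * (2 * C / 2 ^+ k) * `|s| <= L * (2 * C / 2 ^+ k) * d.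
  by apply: ler_wpM2l => //; rewrite mulr_ge0 // -mulrA mulr_ge0.
have h3 : L * (2 * C / 2 ^+ k) * d <= 2^-1 * (2 * C / 2 ^+ k).
  by rewrite mulrAC; apply: ler_wpM2r => //; rewrite -mulrA mulr_ge0.
have h4 := Hv s k.+1; rewrite clamp_id // in h4.
have h5 := ler_distD (u k.+1 s) (H s) (v s); rewrite (distrC (H s) (u _ _)) in h5.
have h6 : 2 * C / 2 ^+ k.+1 = 2^-1 * (2 * C / 2 ^+ k).
  by rewrite exprS invfM mulrCA.
by lra.
Qed.

(** At a point [c] where [|w|] is largest on [-|t|, |t|], the mean value bound reads
    [|w c| <= L * |c| * |w c| <= |w c| / 2]. The smallness of [L * r] takes the place of the
    exponential factor. *)
Lemma gronwall_zero (w : R^o -> E) (L r : R) : 0 <= L -> L * r <= 2^-1 ->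
  (forall t : R^o, `|t| < r -> derivable w t 1 /\ `|'D_1 w t| <= L * `|w t|) ->
  w 0 = 0 -> forall t : R^o, `|t| < r -> w t = 0.
Proof.
move=> L0 Lr Hw w0 t tr; pose d : R := `|t|.
have dd : - d <= d by have := normr_ge0 t; rewrite /d; lra.
have ind s : s \in `[- d, d] -> `|s| <= d by rewrite in_itv /= ler_norml.
have cont : {within `[- d, d], continuous (fun s : R^o => `|w s| : R^o)}.
  apply/continuous_in_subspaceT => z /[1!inE] /ind zd.
  apply: (@continuous_comp _ _ _ w (fun y : E => `|y| : R^o)).
    have [dw _] := Hw z (le_lt_trans zd tr).
    by apply/differentiable_continuous/derivable1_diffP.
  exact: norm_continuous.
have [c cd Mc] := EVT_max dd cont.
have cd' := ind _ cd.
have Hs s : `|s| <= d -> derivable w s 1 /\ `|'D_1 w s| <= L * `|w c|.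
  move=> sd; have [dw bw] := Hw s (le_lt_trans sd tr); split => //.
  apply: le_trans bw _; apply: ler_wpM2l => //; apply: Mc.
  by rewrite in_itv /= -ler_norml.
have := norm_MVT0 Hs cd'; rewrite w0 subr0 => hc.
have h1 : L * `|w c| * `|c| <= 2^-1 * `|w c|.
  rewrite mulrAC; apply: ler_wpM2r => //; apply: le_trans Lr.
  by apply: ler_wpM2l => //; apply: le_trans cd' (ltW tr).
have h2 : `|w t| <= `|w c|.
  by apply: Mc; rewrite in_itv /= -ler_norml.
have h3 := normr_ge0 (w c).
by apply/eqP; rewrite -normr_le0; lra.
Qed.

(* Composing a field that is Lipschitz on a box with this retraction makes it
   globally Lipschitz, so that the Picard iterates are defined everywhere. *)
Definition clamp_box (e : E) (r : R) (p : E) : E :=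
  e + \row_i clamp r (p 0 i - e 0 i).

Lemma clamp_box_norm e r p : 0 <= r -> `|clamp_box e r p - e| <= r.
Proof.
move=> r0; rewrite /clamp_box addrAC subrr add0r; apply: rV_norm_le => // i.
by rewrite mxE; exact: clamp_norm.
Qed.

Lemma clamp_box_id e r p : `|p - e| <= r -> clamp_box e r p = p.
Proof.
move=> pr; apply/rowP => i; rewrite !mxE clamp_id; first by rewrite addrC subrK.
by apply: le_trans pr; have := coord_norm_le (p - e) i; rewrite !mxE.
Qed.

Lemma clamp_box_lipschitz e r p q :
  `|clamp_box e r p - clamp_box e r q| <= `|p - q|.
Proof.
apply: rV_norm_le => // i; rewrite !mxE opprD addrACA subrr add0r.
apply: le_trans (clamp_lipschitz _ _ _) _; rewrite opprB addrA subrK.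
by have := coord_norm_le (p - q) i; rewrite !mxE.
Qed.

(** The field is clamped to a box and solved globally; for short times the solution stays in the
    box, where the clamp is the identity. The constants are exported because [ode_unique] must use
    the same box, Lipschitz constant and time. *)
Lemma ode_local_solution (V : E -> E) (U : set E) (e : E) :
  open U -> Ck_on 1 U V -> U e ->
  exists (r L d : R) (u : R^o -> E),
  [/\ [/\ 0 < r, 0 <= L, 0 < d & L * d <= 2^-1],
    forall p, `|p - e| <= r -> U p,
    forall p q, `|p - e| <= r -> `|q - e| <= r -> `|V p - V q| <= L * `|p - q|,
    u 0 = e &
    forall t : R^o, `|t| <= d ->
      `|u t - e| <= r /\ is_derive t (1 : R^o) u (V (u t))].
Proof.
move=> oU HV Ue; have [r [L [r0 L0 HU HL]]] := C1_lipschitz oU HV Ue.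
have [|d1 [u [d10 u0 du]]] := @picard (V \o clamp_box e r) L e L0.
  move=> p q; apply: le_trans (HL _ _ _ _) _; try exact/clamp_box_norm/ltW.
  by apply: ler_wpM2l => //; exact: clamp_box_lipschitz.
have cu : {for (0 : R^o), continuous u}.
  have z : `|0 : R^o| <= d1 by rewrite normr0 ltW.
  by have [du0 _] := du 0 z; apply/differentiable_continuous/derivable1_diffP.
have near_u : \forall t \near (0 : R^o), `|u t - e| <= r.
  have near_c := (cvgrPdist_le _ _).1 cu r r0.
  by apply: filterS (near_c _) => t; rewrite u0 distrC.
have [d2 /= d20 Hd2] := (nbhs_ballP _ _).1 near_u.
(* The three bounds give existence, confinement to the box (halved, since [|t| <= d] is closed and
   the ball open), and [L * d <= 1/2]. *)
pose d := Num.min d1 (Num.min (d2 / 2) (2 * (L + 1))^-1).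
have L1 : 0 < 2 * (L + 1) by rewrite mulr_gt0 // ltr_wpDl.
have dpos : 0 < d by rewrite !lt_min d10 divr_gt0 // invr_gt0.
have [dd1 dd2 dd3] : [/\ d <= d1, d <= d2 / 2 & d <= (2 * (L + 1))^-1].
  by rewrite /d !ge_min !lexx !orbT.
exists r, L, d, u; split => //.
  split => //; apply: le_trans (ler_wpM2l L0 dd3) _.
  by rewrite invfM mulrCA ler_piMr // ler_pdivrMr ?ltr_wpDl // mul1r lerDl.
move=> t td; have ur : `|u t - e| <= r.
  apply: Hd2; rewrite -ball_normE /= sub0r normrN.
  by apply: le_lt_trans (le_trans td dd2) _; rewrite ltr_pdivrMr // ltr_pMr // ltr1n.
split => //; have := du t (le_trans td dd1).
by rewrite /= clamp_box_id.
Qed.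

Lemma ode_unique (V : E -> E) (e : E) (r L d : R) (u v : R^o -> E) :
  0 <= L -> L * d <= 2^-1 ->
  (forall p q, `|p - e| <= r -> `|q - e| <= r -> `|V p - V q| <= L * `|p - q|) ->
  (forall t : R^o, `|t| < d ->
    [/\ `|u t - e| <= r, `|v t - e| <= r, is_derive t (1 : R^o) u (V (u t)) &
      is_derive t (1 : R^o) v (V (v t))]) ->
  u 0 = v 0 -> forall t : R^o, `|t| < d -> u t = v t.
Proof.
move=> L0 Ld HL Huv uv0 t td; apply/eqP; rewrite -subr_eq0; apply/eqP.
apply: (@gronwall_zero (fun s => u s - v s) L d L0 Ld) => //; last first.
  by rewrite uv0 subrr.
move=> s /Huv [us vs du dv]; have [d1 ->] := is_derive_sub du dv.
by split => //; exact: HL.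
Qed.

End ODE.

(** * Tangent maps in charts *)

Section DiffApply.
Context {R : realType}.
Implicit Types E F H : normedModType R.

Lemma near_eq_diffE E F (f g : E -> F) x y : (\near x, f x = g x) ->
  differentiable f x -> 'd f x y = 'd g x y.
Proof. by move=> fg df; rewrite (near_eq_diff fg df). Qed.

(** The chain rule up to germs: inserting [cinv \o cmap] between two coordinate expressions changes
    nothing only near the point. *)
Lemma near_diff_comp E F H (f : E -> F) (g : F -> H) (h : E -> H) x z y :
  f x = z -> differentiable f x -> differentiable g z ->
  (\near x, g (f x) = h x) -> 'd g z ('d f x y) = 'd h x y.
Proof.
move=> <- df dg gfh.
have <- : 'd (g \o f) x y = 'd g (f x) ('d f x y) by rewrite diff_comp.
by apply: near_eq_diffE => //; exact: differentiable_comp.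
Qed.

Lemma near_id_diff E (f : E -> E) x y : (\near x, f x = x) -> 'd f x y = y.
Proof.
move=> fx; have fx' : \near x, id x = f x by apply: filterS fx => z ->.
have did : differentiable (id : E -> E) x by [].
by rewrite -(near_eq_diffE y fx' did) diff_val.
Qed.

End DiffApply.

Section Charts.
Context {R : realType} {n : nat}.
Local Notation E := 'rV[R]_n.

Section Topological.
Context {M : topologicalType}.
Implicit Types (phi psi : chart R n M) (x : M) (p : E).

Lemma cmap_target phi x : dom phi x -> target phi (cmap phi x).
Proof. by exists x. Qed.

Lemma cinv_dom phi p : target phi p -> dom phi (cinv phi p).
Proof. by case=> x dx <-; rewrite cmapK. Qed.

Lemma cinvK phi p : target phi p -> cmap phi (cinv phi p) = p.
Proof. by case=> x dx <-; rewrite cmapK. Qed.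

Lemma open_target phi : open (target phi).
Proof. exact: target_open. Qed.

Lemma near_target phi p : target phi p -> \forall q \near p, target phi q.
Proof. by move=> tp; apply: open_nbhs_nbhs; split => //; exact: open_target. Qed.

Lemma near_cinv phi p (D : set M) : target phi p -> open D -> D (cinv phi p) ->
  \forall q \near p, D (cinv phi q).
Proof.
move=> tp oD Dp; apply: (cinv_continuous tp).
by apply: open_nbhs_nbhs.
Qed.

Lemma near_cmap phi x : dom phi x -> \forall y \near x, dom phi y.
Proof. by move=> dx; apply: open_nbhs_nbhs; split => //; exact: dom_open. Qed.

End Topological.

Section Smooth.
Context {M : manifoldType R n}.
Implicit Types (phi psi : chart R n M) (x : M) (p : E).

Lemma transition_differentiable phi psi x : atlas phi -> atlas psi ->
  dom phi x -> dom psi x -> differentiable (cmap psi \o cinv phi) (cmap phi x).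
Proof.
move=> aphi apsi dphi dpsi.
have [d _] := transition_smooth _ _ aphi apsi 1%N.
by apply: d; exists x.
Qed.

(** The two transition maps are mutually inverse near the point. The resulting injectivity carries
    nonzero vectors, and so the positivity of the fundamental tensor, into charts. *)
Lemma vec_of_chartK phi x (y : E) : atlas phi -> dom phi x ->
  'd (cmap phi \o cinv (chart_at x)) (cmap (chart_at x) x)
     (vec_of_chart phi x y) = y.
Proof.
move=> aphi dphi; have ac := chart_at_atlas x; have dc := chart_at_dom x.
have d1 := transition_differentiable aphi ac dphi dc.
have d2 := transition_differentiable ac aphi dc dphi.
rewrite /vec_of_chart.
transitivity ('d (id : E -> E) (cmap phi x) y); last by rewrite diff_val.
apply: near_diff_comp => //=; first by rewrite cmapK.
have n1 := near_target (cmap_target dphi).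
have n2 : \forall q \near cmap phi x, dom (chart_at x) (cinv phi q).
  by apply: near_cinv; [exact: cmap_target|exact: dom_open|rewrite cmapK].
apply: filterS2 n1 n2 => q tq dq /=.
by rewrite cmapK // cinvK.
Qed.

Lemma vec_of_chart_eq0 phi x (y : E) : atlas phi -> dom phi x ->
  vec_of_chart phi x y = 0 :> E -> y = 0.
Proof.
move=> aphi dphi y0; rewrite -[y](vec_of_chartK _ aphi dphi) y0.
by rewrite linear0.
Qed.

Lemma vec_of_chart_at x (y : E) : vec_of_chart (chart_at x) x y = y :> E.
Proof.
have dc := chart_at_dom x; apply: near_id_diff.
by apply: filterS (near_target (cmap_target dc)) => q tq /=; rewrite cinvK.
Qed.

End Smooth.

Section Maps.
Context {M N : manifoldType R n}.

(** Continuity is a separate clause because [cmap psi] is arbitrary off [dom psi]: differentiability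
    of the coordinate expression does not by itself keep [f] in [dom psi] near [x]. *)
Definition mdifferentiable (f : M -> N) (x : M) : Prop :=
  {for x, continuous f} /\
  forall (phi : chart R n M) (psi : chart R n N), atlas phi -> atlas psi ->
    dom phi x -> dom psi (f x) ->
    differentiable (cmap psi \o f \o cinv phi) (cmap phi x).

(** Both sides are the differential of [g], the expression of [f] from [phi] to the preferred chart
    at [f x]; each equality is a chain rule through a transition map. *)
Lemma mdiff_chart (f : M -> N) (x : M) (phi : chart R n M) (psi : chart R n N)
    (y : E) : mdifferentiable f x -> atlas phi -> atlas psi -> dom phi x ->
  dom psi (f x) ->
  mdiff f (vec_of_chart phi x y) =
  vec_of_chart psi (f x) ('d (cmap psi \o f \o cinv phi) (cmap phi x) y) :> E.
Proof.
move=> [cf df] aphi apsi dphi dpsi.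
have ac := chart_at_atlas x; have dc := chart_at_dom x.
have af := chart_at_atlas (f x); have dfx := chart_at_dom (f x).
have n1 := near_target (cmap_target dphi).
have fcont : {for cmap phi x, continuous (f \o cinv phi)}.
  apply: continuous_comp; first exact: (cinv_continuous (cmap_target dphi)).
  by rewrite cmapK.
pose g := cmap (chart_at (f x)) \o f \o cinv phi.
have -> : mdiff f (vec_of_chart phi x y) = 'd g (cmap phi x) y :> E.
  rewrite /mdiff /vec_of_chart.
  have d1 := transition_differentiable aphi ac dphi dc.
  have d2 := df _ _ ac af dc dfx.
  apply: (near_diff_comp _ _ d1 d2); first by rewrite /= cmapK.
  have n2 : \forall q \near cmap phi x, dom (chart_at x) (cinv phi q).
    by apply: near_cinv; [exact: cmap_target|exact: dom_open|rewrite cmapK].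
  by apply: filterS n2 => q dq; rewrite /g /= cmapK.
have d1 := df _ _ aphi apsi dphi dpsi.
have d2 := transition_differentiable apsi af dpsi dfx.
apply/esym; apply: (near_diff_comp _ _ d1 d2); first by rewrite /= cmapK.
have n2 : \forall q \near cmap phi x, dom psi (f (cinv phi q)).
  by apply: fcont; rewrite /= cmapK //; exact: near_cmap.
by apply: filterS n2 => q dq; rewrite /g /= cmapK.
Qed.

End Maps.
End Charts.

(** * Left-invariant fields and one-parameter subgroups *)

Section LieGroup.
Context {R : realType} {n : nat} {G : lieGroupType R n}.
Local Notation E := 'rV[R]_n.
Local Notation c1 := (chart_at (1%g : G)).
Local Notation e0 := (cmap c1 (1%g : G)).
Implicit Types (phi psi chi : chart R n G) (x a : G) (p q X : E).

Definition chart_mul phi psi chi (z : E * E) : E :=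
  cmap chi (cinv phi z.1 * cinv psi z.2)%g.

Definition chart_mul_dom phi psi chi : set (E * E) :=
  [set z | [/\ target phi z.1, target psi z.2 &
    dom chi (cinv phi z.1 * cinv psi z.2)%g]].

Lemma mul_continuous x y : {for (x, y), continuous (fun z : G * G => z.1 * z.2)%g}.
Proof. exact: lie_mul_continuous. Qed.

Lemma lmul_continuous a x : {for x, continuous (fun y : G => a * y)%g}.
Proof.
apply: (@continuous_comp _ _ _ (fun y : G => (a, y)) (fun z : G * G => z.1 * z.2)%g).
  by apply: cvg_pair; [exact: cvg_cst|exact: cvg_id].
exact: mul_continuous.
Qed.

Lemma rmul_continuous a x : {for x, continuous (fun y : G => y * a)%g}.
Proof.
apply: (@continuous_comp _ _ _ (fun y : G => (y, a)) (fun z : G * G => z.1 * z.2)%g).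
  by apply: cvg_pair; [exact: cvg_id|exact: cvg_cst].
exact: mul_continuous.
Qed.

Lemma open_chart_mul_dom phi psi chi : open (chart_mul_dom phi psi chi).
Proof.
rewrite openE => -[p q] [/= tp tq d]; rewrite /interior.
have n1 : \forall z \near (p, q), target phi z.1.
  by apply: (cvg_fst (F := nbhs p) (G := nbhs q)); exact: near_target.
have n2 : \forall z \near (p, q), target psi z.2.
  by apply: (cvg_snd (F := nbhs p) (G := nbhs q)); exact: near_target.
have n3 : \forall z \near (p, q), dom chi (cinv phi z.1 * cinv psi z.2)%g.
  have c : {for (p, q), continuous
      (fun z : E * E => (cinv phi z.1 * cinv psi z.2)%g)}.
    apply: (@continuous_comp _ _ _ (fun z : E * E => (cinv phi z.1, cinv psi z.2))
      (fun z : G * G => z.1 * z.2)%g); last exact: mul_continuous.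
    apply: cvg_pair.
      apply: (@continuous_comp _ _ _ fst (cinv phi)); first exact: cvg_fst.
      exact: cinv_continuous.
    apply: (@continuous_comp _ _ _ snd (cinv psi)); first exact: cvg_snd.
    exact: cinv_continuous.
  by apply: c; exact: near_cmap.
by apply: filterS3 n1 n2 n3 => z h1 h2 h3; split.
Qed.

Lemma chart_mul_smooth phi psi chi : atlas phi -> atlas psi -> atlas chi ->
  smooth_on (chart_mul_dom phi psi chi) (chart_mul phi psi chi).
Proof. by move=> h1 h2 h3; exact: lie_mul_smooth. Qed.

Lemma lmul_mdifferentiable a x : mdifferentiable (fun y : G => a * y)%g x.
Proof.
split; first exact: lmul_continuous.
move=> phi psi aphi apsi dphi dpsi.
have aa := chart_at_atlas a; have da := chart_at_dom a.
have S := chart_mul_smooth aa aphi apsi.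
have d1 : differentiable (chart_mul (chart_at a) phi psi)
    (cmap (chart_at a) a, cmap phi x).
  apply: (smooth_on_differentiable S).
  by split => /=; rewrite ?cmapK //; exact: cmap_target.
have := differentiable_comp (pairr_differentiable (cmap (chart_at a) a) (cmap phi x)) d1.
by rewrite /chart_mul /comp /= cmapK.
Qed.

Lemma rmul_mdifferentiable a x : mdifferentiable (fun y : G => y * a)%g x.
Proof.
split; first exact: rmul_continuous.
move=> phi psi aphi apsi dphi dpsi.
have aa := chart_at_atlas a; have da := chart_at_dom a.
have S := chart_mul_smooth aphi aa apsi.
have d1 : differentiable (chart_mul phi (chart_at a) psi)
    (cmap phi x, cmap (chart_at a) a).
  apply: (smooth_on_differentiable S).
  by split => /=; rewrite ?cmapK //; exact: cmap_target.
have := differentiable_comp (pairl_differentiable (cmap (chart_at a) a) (cmap phi x)) d1.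
by rewrite /chart_mul /comp /= cmapK.
Qed.

(* The left-invariant vector field with value [X] at the identity, in the
   chart [phi]. *)
Definition left_field phi X p : E :=
  'D_(0 : E, X) (chart_mul phi c1 phi) (p, e0).

Lemma chart_mul_dom1 phi p : target phi p -> chart_mul_dom phi c1 phi (p, e0).
Proof.
move=> tp; have d1 := chart_at_dom (1%g : G).
split => //=; first exact: cmap_target.
by rewrite (cmapK d1) mulg1; exact: cinv_dom.
Qed.

Lemma left_field_smooth phi X : atlas phi ->
  smooth_on (target phi) (left_field phi X).
Proof.
move=> aphi k; have S := chart_mul_smooth aphi (chart_at_atlas (1%g : G)) aphi.
apply: (@Ck_on_sub _ _ _ k ((fun p : E => (p, e0)) @^-1` chart_mul_dom phi c1 phi)).
  by move=> p; exact: chart_mul_dom1.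
apply: (@Ck_on_comp_affine _ _ _ _ k _ (fun p : E => (p, e0)) (fun v => (v, 0))
  ('D_(0 : E, X) (chart_mul phi c1 phi))).
- by move=> h p v; exact: pairl_affine.
- by move=> p; exact: pairl_differentiable.
- by have [_ D] := S k.+1; exact: D.
Qed.

Lemma left_fieldE phi X x : atlas phi -> dom phi x ->
  left_field phi X (cmap phi x) =
  'd (cmap phi \o (fun y : G => x * y)%g \o cinv c1) e0 X.
Proof.
move=> aphi dphi; have d1 := chart_at_dom (1%g : G).
have [_ dl] := lmul_mdifferentiable x 1%g.
have dx : dom phi (x * 1)%g by rewrite mulg1.
rewrite -deriveE; last exact: dl (chart_at_atlas _) aphi d1 dx.
rewrite /left_field -(derive_comp_affine (A := fun q : E => (cmap phi x, q))
  (L := fun v => (0 : E, v))); last by move=> h; exact: pairr_affine.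
by rewrite /comp /chart_mul /= cmapK.
Qed.

Lemma left_invariant_field (F : forall x : G, tangent x -> R) X x phi :
  (forall (a x : G) (v : tangent x),
     F (a * x)%g (mdiff (fun y : G => (a * y)%g) v) = F x v) ->
  atlas phi -> dom phi x ->
  F x (vec_of_chart phi x (left_field phi X (cmap phi x))) = F 1%g X.
Proof.
move=> Finv aphi dphi; have d1 := chart_at_dom (1%g : G).
have a1 := chart_at_atlas (1%g : G).
have dx : dom phi (x * 1)%g by rewrite mulg1.
have := Finv x 1%g X.
rewrite -{1}(vec_of_chart_at (1%g : G) X).
rewrite (mdiff_chart _ (lmul_mdifferentiable x 1%g) a1 aphi d1 dx).
rewrite -(left_fieldE X aphi dphi) => <-; set w := left_field _ _ _.
(* The tangent space depends on its point, so [x * 1 = x] cannot be rewritten in place; a variable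
   point [z] is substituted instead. *)
suff H z : z = x -> F x (vec_of_chart phi x w) = F z (vec_of_chart phi z w).
  exact: H (mulg1 x).
by move=> ->.
Qed.

(** Associativity, differentiated: translating by [x] and then by [a] is translating by [a * x]. *)
Lemma left_field_lmul phi psi X a x : atlas phi -> atlas psi -> dom phi x ->
  dom psi (a * x)%g ->
  'd (cmap psi \o (fun y : G => a * y)%g \o cinv phi) (cmap phi x)
     (left_field phi X (cmap phi x)) =
  left_field psi X (cmap psi (a * x)%g).
Proof.
move=> aphi apsi dphi dpsi; rewrite !left_fieldE //.
have d1 := chart_at_dom (1%g : G); have a1 := chart_at_atlas (1%g : G).
have [cx dx] := lmul_mdifferentiable x 1%g.
have [_ da] := lmul_mdifferentiable a x.
have dx1 : dom phi (x * 1)%g by rewrite mulg1.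
have D1 := dx _ _ a1 aphi d1 dx1.
have D2 := da _ _ aphi apsi dphi dpsi.
apply: (near_diff_comp _ _ D1 D2); first by rewrite /= (cmapK d1) mulg1.
have te := cmap_target d1.
have n2 : \forall q \near e0, dom phi (x * cinv c1 q)%g.
  have cc : {for e0, continuous ((fun y : G => x * y)%g \o cinv c1)}.
    apply: continuous_comp; first exact: cinv_continuous.
    by rewrite (cmapK d1).
  by apply: cc; rewrite /= (cmapK d1) mulg1; exact: near_cmap.
by apply: filterS n2 => q dq; rewrite /= (cmapK dq) mulgA.
Qed.

Lemma left_field1 X : left_field c1 X e0 = X.
Proof.
have d1 := chart_at_dom (1%g : G); have a1 := chart_at_atlas (1%g : G).
rewrite left_fieldE //; apply: near_id_diff.
by apply: filterS (near_target (cmap_target d1)) => q tq /=; rewrite mul1g cinvK.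
Qed.

End LieGroup.

(** * Smoothness of integral curves *)

Section FlowSmooth.
Context {R : realType} {n : nat}.
Local Notation E := 'rV[R]_n.

(* If [u' = V u], then [(h \o u)' = (V h) \o u], where [V h] is as smooth as
   [h] and [V]: this bootstraps the smoothness of [u]. *)
Lemma ode_solution_Ck k (U : set E) (O : set R^o) (V : E -> E) (u : R^o -> E)
    (h : E -> R^o) :
  open U -> open O -> smooth_on U V ->
  (forall t, O t -> U (u t) /\ is_derive t (1 : R^o) u (V (u t))) ->
  smooth_on U h -> Ck_on k O (h \o u).
Proof.
move=> oU oO SV Hu; elim: k h => [|k IH] h Sh.
  move=> t Ot; have [Ut [du _]] := Hu t Ot; apply: continuous_comp.
    by apply/differentiable_continuous/derivable1_diffP.
  exact: (Ck_on_continuous (Sh 0%N)).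
have dhu t : O t -> is_derive t (1 : R^o) (h \o u) ('D_(V (u t)) h (u t)).
  move=> Ot; have [Ut du] := Hu t Ot; apply: is_derive_curve => //.
  exact: smooth_on_differentiable Sh Ut.
split=> [t Ot|v].
  by have [d _] := dhu t Ot; apply/derivable1_diffP.
(* [v] times the derivative of [h] along the field [V], written in coordinates to exhibit its
   smoothness; the factor [v] is there because directions on the line are scalars. *)
pose H : E -> R^o := \sum_(i < n) ((fun p => v : R^o) * (fun p => V p 0 i : R^o) *
  ('D_(delta_mx 0 i) h : E -> R^o)).
have SH : smooth_on U H.
  move=> j; apply: Ck_on_sum => // i; apply: Ck_onM => //.
    apply: Ck_onM => //; first exact: Ck_on_cst.
    by apply: Ck_on_coord => //; exact: SV.
  exact: smooth_on_derive.
apply: eq_Ck_on (IH H SH) => // t Ot.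
have [d1 e1] := dhu t Ot; have [Ut _] := Hu t Ot.
have dh := smooth_on_differentiable Sh Ut.
have -> : 'D_v (h \o u) t = v *: 'D_(1 : R^o) (h \o u) t.
  have dd : differentiable (h \o u) t by apply/derivable1_diffP.
  by rewrite !deriveE // -[in LHS](mulr1 v) -[v * 1]/(v *: (1 : R^o)) linearZ.
rewrite e1 derive_sum_basis // scaler_sumr /H /= fct_sumE.
by apply: eq_bigr => i _; rewrite scalerA.
Qed.

End FlowSmooth.

(** * One-parameter subgroups as integral curves, and their uniqueness *)

Section Subgroups.
Context {R : realType} {n : nat} {G : lieGroupType R n}.
Local Notation E := 'rV[R]_n.
Local Notation c1 := (chart_at (1%g : G)).
Local Notation e0 := (cmap c1 (1%g : G)).
Implicit Types (phi psi : chart R n G) (X : E) (c : R -> G).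

Definition additive_curve c := forall s t, c (s + t) = (c s * c t)%g.

Lemma additive_curve0 c : additive_curve c -> c 0 = 1%g.
Proof.
move=> hc; have := hc 0 0; rewrite addr0 -{1}[c 0]mulg1.
by move/mulgI.
Qed.

Lemma additive_curve_expg c t k : additive_curve c -> c (t *+ k) = (c t ^+ k)%g.
Proof.
move=> hc; elim: k => [|k IH]; first by rewrite mulr0n expg0 additive_curve0.
by rewrite mulrS expgS hc IH.
Qed.

(** Since c(t + s) = c(t)c(s), the curve near [t] is the left translate of the curve near 0, so one
    derivative at 0 determines all the others. *)
Lemma additive_curve_derive c X phi t : additive_curve c -> continuous c ->
  is_derive (0 : R^o) (1 : R^o) (cmap c1 \o c) X -> atlas phi ->
  dom phi (c t) ->
  is_derive (t : R^o) (1 : R^o) (cmap phi \o c) (left_field phi X (cmap phi (c t))).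
Proof.
move=> hc cc dc aphi dphi; apply: is_derive_shift0.
have c0 := additive_curve0 hc; have d1 := chart_at_dom (1%g : G).
have a1 := chart_at_atlas (1%g : G).
have dx : dom phi (c t * 1)%g by rewrite mulg1.
have [_ /(_ _ _ a1 aphi d1 dx) dl] := lmul_mdifferentiable (c t) 1%g.
set f := cmap phi \o _ \o cinv c1 in dl.
have dl' : differentiable f ((cmap c1 \o c) 0) by rewrite /= c0.
have E1 : 'D_X f e0 = left_field phi X (cmap phi (c t)).
  by rewrite (left_fieldE X aphi dphi) deriveE.
have := is_derive_curve dl' dc; rewrite /= c0 E1.
apply: near_eq_is_derive.
have n1 : \forall s \near (0 : R), dom c1 (c s).
  by apply: cc; rewrite c0; exact: near_cmap.
apply: filterS n1 => s ds; rewrite /f /= cmapK //.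
by rewrite addrC hc.
Qed.

(** In every chart the curve solves the equation of a smooth field; [ode_solution_Ck] is applied
    with the coordinate functions as [h]. *)
Lemma additive_smooth_curve c X : additive_curve c -> continuous c ->
  is_derive (0 : R^o) (1 : R^o) (cmap c1 \o c) X -> smooth_curve c.
Proof.
move=> hc cc dc; split => // phi aphi k.
have oO : open (c @^-1` dom phi) by apply: open_comp => //; exact: dom_open.
apply: Ck_on_row => // i.
apply: (@ode_solution_Ck _ _ k (target phi) _ (left_field phi X) (cmap phi \o c)
  (fun p => p 0 i : R^o)) => //.
- exact: open_target.
- exact: left_field_smooth.
- move=> t Ot; split; first exact: cmap_target.
  exact: additive_curve_derive.
- move=> j; apply: Ck_on_coord; first exact: open_target.
  case: j => [|j]; first by move=> p _; exact: cvg_id.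
  split=> [p _|v]; first by [].
  rewrite (_ : (fun x => _) = cst v); first exact: Ck_on_cst.
  by apply/funext => p; rewrite derive_id.
Qed.

Lemma one_parameter_subgroupP X c : one_parameter_subgroup X c ->
  [/\ additive_curve c, continuous c &
    is_derive (0 : R^o) (1 : R^o) (cmap c1 \o c) X].
Proof.
move=> [[cc Sc] hc vc]; have c0 := additive_curve0 hc.
have a1 := chart_at_atlas (1%g : G); have d1 := chart_at_dom (1%g : G).
split => //; apply: DeriveDef.
  apply: diff_derivable; apply: smooth_on_differentiable (Sc _ a1) _.
  by rewrite /= c0.
by move: vc; rewrite /velocity c0 derive1E.
Qed.

(** Uniqueness for the differential equation gives agreement only for [|t| < d]. A general [t] is
    divided by an integer [N] exceeding [|t| / d], and the N-th powers of equal elements are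
    equal. *)
Lemma additive_curve_unique c c' X : additive_curve c -> additive_curve c' ->
  continuous c -> continuous c' ->
  is_derive (0 : R^o) (1 : R^o) (cmap c1 \o c) X ->
  is_derive (0 : R^o) (1 : R^o) (cmap c1 \o c') X -> c =1 c'.
Proof.
move=> hc hc' cc cc' dc dc'.
have a1 := chart_at_atlas (1%g : G); have d1 := chart_at_dom (1%g : G).
have c0 := additive_curve0 hc; have c0' := additive_curve0 hc'.
have [r [L [r0 L0 HU HL]]] := C1_lipschitz (@open_target _ _ _ c1)
  (left_field_smooth X a1 1%N) (cmap_target d1).
have near_ball (b : R -> G) : additive_curve b -> continuous b ->
    \forall t \near (0 : R), dom c1 (b t) /\ `|cmap c1 (b t) - e0| <= r.
  move=> hb cb; have b0 := additive_curve0 hb.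
  have n1 : \forall t \near (0 : R), dom c1 (b t).
    by apply: cb; rewrite b0; exact: near_cmap.
  have cu : {for (0 : R), continuous (cmap c1 \o b)}.
    apply: continuous_comp; first exact: cb.
    by rewrite b0; exact: cmap_continuous.
  have n2 := (cvgrPdist_le _ _).1 cu r r0.
  by apply: filterS2 n1 (n2 _) => t h1; rewrite /= b0 distrC.
have nn := filterI (near_ball c hc cc) (near_ball c' hc' cc').
have [d2 /= d20 Hd2] := (nbhs_ballP _ _).1 (nn _).
have L1 : 0 < 2 * (L + 1) by rewrite mulr_gt0 // ltr_wpDl.
pose d := Num.min d2 (2 * (L + 1))^-1.
have d0 : 0 < d by rewrite lt_min d20 invr_gt0.
have Ld : L * d <= 2^-1.
  have dd : d <= (2 * (L + 1))^-1 by rewrite /d ge_min lexx orbT.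
  apply: le_trans (ler_wpM2l L0 dd) _.
  by rewrite invfM mulrCA ler_piMr // ler_pdivrMr ?ltr_wpDl // mul1r lerDl.
have inb (t : R) : `|t| < d -> ball (0 : R) d2 t.
  rewrite -ball_normE /= sub0r normrN => td.
  by apply: lt_le_trans td _; rewrite /d ge_min lexx.
have loc (t : R) : `|t| < d -> c t = c' t.
  move=> td; have [[h1 _] [h2 _]] := Hd2 _ (inb t td).
  rewrite -(cmapK h1) -(cmapK h2); congr (cinv c1 _).
  apply: (@ode_unique _ _ (left_field c1 X) e0 r L d (cmap c1 \o c)
    (cmap c1 \o c') L0 Ld HL); [|by rewrite /= c0 c0'|exact: td].
  move=> s /inb /Hd2 [[h3 h4] [h5 h6]]; split; [exact: h4|exact: h6| |].
    exact: additive_curve_derive.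
  exact: additive_curve_derive.
move=> t; pose N := (Num.truncn (`|t| / d)).+1.
have tN : `|t / N%:R| < d.
  rewrite normrM normfV normr_nat ltr_pdivrMr ?ltr0n // mulrC -ltr_pdivrMr //.
  exact: truncnS_gt.
have tE : t = (t / N%:R) *+ N by rewrite -mulr_natr divfK // pnatr_eq0.
by rewrite tE !additive_curve_expg // loc.
Qed.

End Subgroups.

(** * Extending a local homomorphism from the line to a group *)

Section LocalToGlobal.
Context {R : realType} {G : groupType}.
Variables (b : R -> G) (d : R).
Hypotheses (d0 : 0 < d)
  (hb : forall s t, `|s| < d -> `|t| < d -> b (s + t) = (b s * b t)%g).

(** The successor makes the step [t / steps t] strictly shorter than [d] and the count nonzero. *)
Definition steps (t : R) : nat := (Num.truncn (`|t| / d)).+1.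

(* Independent of the number of steps by [extendE]. *)
Definition extend (t : R) : G := (b (t / (steps t)%:R) ^+ steps t)%g.

Lemma lt_steps t : `|t| < d * (steps t)%:R.
Proof. by rewrite mulrC -ltr_pdivrMr //; exact: truncnS_gt. Qed.

Lemma local_expg x k : `|x| * k.+1%:R < d -> b (x *+ k.+1) = (b x ^+ k.+1)%g.
Proof.
elim: k => [|k IH] xk; first by rewrite mulr1n expg1.
have xk' : `|x| * k.+1%:R < d.
  by apply: le_lt_trans xk; apply: ler_wpM2l => //; rewrite ler_nat.
rewrite mulrSr expgSr hb ?IH //.
  by rewrite normrMn -mulr_natr.
by apply: le_lt_trans xk; rewrite ler_peMr // ler1n.
Qed.

(** Two subdivisions of [t] are compared through their common refinement, whose number of steps is
    the product; [aux] breaks each long step into short ones. *)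
Lemma extendE t k : `|t| < d * k.+1%:R -> extend t = (b (t / k.+1%:R) ^+ k.+1)%g.
Proof.
have aux m j : `|t| < d * m.+1%:R ->
    b (t / m.+1%:R) = (b (t / (m.+1 * j.+1)%:R) ^+ j.+1)%g.
  have divE (x : R) : x / (m.+1 * j.+1)%:R * j.+1%:R = x / m.+1%:R.
    by rewrite natrM invfM mulrA divfK // pnatr_eq0.
  move=> tm; rewrite -local_expg; first by rewrite -[_ *+ j.+1]mulr_natr divE.
  by rewrite normrM normfV normr_nat divE ltr_pdivrMr ?ltr0n.
move=> tk; rewrite /extend /steps (aux _ k (lt_steps t)).
rewrite (aux k (Num.truncn (`|t| / d)) tk) -!expgnA [in LHS]mulnC.
by rewrite mulnC.
Qed.

Lemma extend_id t : `|t| < d -> extend t = b t.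
Proof. by move=> td; rewrite (@extendE t 0) ?mulr1 // divr1 expg1. Qed.

(** A subdivision fine enough for [|s| + |t|] serves [s], [t] and [s + t] at once. The small factors
    commute because addition of times does, so the power of their product splits. *)
Lemma extendD s t : extend (s + t) = (extend s * extend t)%g.
Proof.
pose k := Num.truncn ((`|s| + `|t|) / d).
have stk : `|s| + `|t| < d * k.+1%:R.
  by rewrite mulrC -ltr_pdivrMr //; exact: truncnS_gt.
have sk : `|s| < d * k.+1%:R by apply: le_lt_trans stk; rewrite lerDl.
have tk : `|t| < d * k.+1%:R by apply: le_lt_trans stk; rewrite lerDr.
have hs x : `|x| < d * k.+1%:R -> `|x / k.+1%:R| < d.
  by move=> xk; rewrite normrM normfV normr_nat ltr_pdivrMr ?ltr0n.
rewrite (extendE sk) (extendE tk) (@extendE (s + t) k); last first.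
  exact: le_lt_trans (ler_normD _ _) stk.
rewrite mulrDl (hb (hs s sk) (hs t tk)) expgMn //.
by rewrite /commute -!hb ?hs // addrC.
Qed.

End LocalToGlobal.

(** * Existence of one-parameter subgroups and the value of the exponential *)

Section Existence.
Context {R : realType} {n : nat} {G : lieGroupType R n}.
Local Notation E := 'rV[R]_n.
Local Notation c1 := (chart_at (1%g : G)).
Local Notation e0 := (cmap c1 (1%g : G)).

(** The differential of a left translation carries the field to itself. This provides the second
    solution that uniqueness compares with a time shift of [u]. *)
Lemma left_translate_derive (X p : E) (u : R^o -> E) (q : R^o) :
  is_derive q (1 : R^o) u (left_field c1 X (u q)) ->
  chart_mul_dom c1 c1 c1 (p, u q) ->
  is_derive q (1 : R^o) (fun q : R^o => chart_mul c1 c1 c1 (p, u q))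
    (left_field c1 X (chart_mul c1 c1 c1 (p, u q))).
Proof.
move=> du [/= tp tq dm]; have a1 := chart_at_atlas (1%g : G).
have dx := cinv_dom tq.
have [_ /(_ _ _ a1 a1 dx dm) dl] := lmul_mdifferentiable (cinv c1 p) (cinv c1 (u q)).
have := left_field_lmul X a1 a1 dx dm; rewrite (cinvK tq) in dl *.
move=> LM; have E1 := etrans (deriveE _ dl) LM.
by have := is_derive_curve dl du; rewrite E1.
Qed.

(** As functions of q, [u (q + s)] and the product of [u s] and [u q] solve the same equation and
    both equal [u s] at q = 0. *)
Lemma local_subgroup (X : E) : exists (u : R^o -> E) (d : R),
  [/\ 0 < d, u 0 = e0, is_derive (0 : R^o) (1 : R^o) u X,
    forall t : R, `|t| < d -> target c1 (u t) &
    forall s t : R, `|s| < d -> `|t| < d ->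
      cinv c1 (u (s + t)) = (cinv c1 (u s) * cinv c1 (u t))%g].
Proof.
have a1 := chart_at_atlas (1%g : G); have d1 := chart_at_dom (1%g : G).
have te := cmap_target d1.
have [r [L [d [u [[r0 L0 d0 Ld] HU HL u0 Hu]]]]] :=
  ode_local_solution (@open_target _ _ _ c1) (left_field_smooth X a1 1%N) te.
have S := chart_mul_smooth a1 a1 a1.
have dee := chart_mul_dom1 te.
have mee : chart_mul c1 c1 c1 (e0, e0) = e0.
  by rewrite /chart_mul /= !(cmapK d1) mulg1.
have near_mul : \forall z \near (e0, e0), chart_mul_dom c1 c1 c1 z /\
    `|chart_mul c1 c1 c1 z - e0| <= r.
  have n1 : \forall z \near (e0, e0), chart_mul_dom c1 c1 c1 z.
    by apply: open_nbhs_nbhs; split => //; exact: open_chart_mul_dom.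
  have n2 := (cvgrPdist_le _ _).1 (Ck_on_continuous (S 0%N) dee) r r0.
  by apply: filterS2 n1 (n2 _) => z h1 h2; split=> //; rewrite distrC -{1}mee.
have [d2 /= d20 Hd2] := (nbhs_ballP _ _).1 near_mul.
have z : `|0 : R^o| <= d by rewrite normr0 ltW.
have [_ du0] := Hu 0 z; have cu : {for (0 : R^o), continuous u}.
  by have [du _] := du0; apply/differentiable_continuous/derivable1_diffP.
have near_u := (cvgrPdist_lt _ _).1 cu d2 d20.
have [d3 /= d30 Hd3] := (nbhs_ballP _ _).1 (near_u _).
(* [d3] keeps the product in the chart and within [r] of [e0]; [d / 2] keeps a sum of two times in
   the domain of the solution. *)
pose dl := Num.min d3 (d / 2).
have dl0 : 0 < dl by rewrite lt_min d30 divr_gt0.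
have dld : dl <= d / 2 by rewrite /dl ge_min lexx orbT.
have ub (t : R) : `|t| < dl -> `|e0 - u t| < d2.
  move=> tl; rewrite -u0; apply: Hd3; rewrite -ball_normE /= sub0r normrN.
  by apply: lt_le_trans tl _; rewrite /dl ge_min lexx.
have Ht (t : R) : `|t| < dl -> `|t| <= d by move=> ?; lra.
have tu (t : R) : `|t| < dl -> target c1 (u t).
  by move=> /Ht /Hu [h _]; exact: HU.
have mulP (s t : R) : `|s| < dl -> `|t| < dl ->
    chart_mul_dom c1 c1 c1 (u s, u t) /\ `|chart_mul c1 c1 c1 (u s, u t) - e0| <= r.
  move=> hs ht; apply: Hd2; split; rewrite -ball_normE /=; exact: ub.
exists u, dl; split => //.
  by rewrite u0 (left_field1 X) in du0.
move=> s t sl tl.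
have Ldl : L * dl <= 2^-1.
  by apply: le_trans Ld; apply: ler_wpM2l => //; lra.
have Hst (q : R) : `|q| < dl -> `|q + s| <= d.
  by move=> ql; apply: le_trans (ler_normD _ _) _; lra.
have E1 : u (t + s) = chart_mul c1 c1 c1 (u s, u t).
  apply: (@ode_unique _ _ (left_field c1 X) e0 r L dl (fun q : R^o => u (q + s))
    (fun q : R^o => chart_mul c1 c1 c1 (u s, u q)) L0 Ldl HL); [| |exact: tl].
    move=> q ql; have [h1 h2] := Hu _ (Hst q ql).
    have [[h3 h4 h5] h6] := mulP s q sl ql.
    split; [exact: h1|exact: h6| |].
      exact: is_derive_shifted.
    have [_ du'] := Hu q (Ht q ql).
    by apply: left_translate_derive; split.
  rewrite add0r u0 /chart_mul /= (cmapK d1) mulg1 cinvK //; exact: tu.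
have [[h3 h4 h5] h6] := mulP s t sl tl.
by rewrite addrC E1 /chart_mul /= cmapK.
Qed.

Lemma exists_additive_curve (X : E) : exists c : R -> G,
  [/\ additive_curve c, continuous c &
    is_derive (0 : R^o) (1 : R^o) (cmap c1 \o c) X].
Proof.
have [u [d [d0 u0 du tu hu]]] := local_subgroup X.
have d1 := chart_at_dom (1%g : G).
pose b (t : R) : G := cinv c1 (u t).
pose c := extend b d.
have near_d : \forall t \near (0 : R), `|t| < d.
  by apply/nbhs_ballP; exists d => //= t; rewrite -ball_normE /= sub0r normrN.
have cb : \forall t \near (0 : R), b t = c t.
  by apply: filterS near_d => t td; rewrite /c extend_id.
have hc : additive_curve c by move=> s t; exact: extendD.
have c0 := additive_curve0 hc.
have cc0 : {for (0 : R), continuous c}.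
  have : {for (0 : R), continuous b}.
    apply: continuous_comp.
      by have [dd _] := du; apply/differentiable_continuous/derivable1_diffP.
    by apply: cinv_continuous; rewrite u0; exact: cmap_target.
  move=> cb0; suff : c t @[t --> 0] --> c 0 by [].
  rewrite -(nbhs_singleton cb).
  by apply: cvg_trans cb0; exact: near_eq_cvg.
exists c; split => //.
  move=> t.
  (* Continuity at 0 is carried to [t] by left translation. *)
  have cE : c = (fun s : R => (c t * c (s - t))%g).
    by apply/funext => s; rewrite -hc addrC subrK.
  rewrite {1}cE; apply: (@continuous_comp _ _ _ (fun s : R => c (s - t))
    (fun y : G => (c t * y)%g)); last by exact: lmul_continuous.
  apply: (@continuous_comp _ _ _ (fun s : R => s - t) c).
    by apply: continuousB; [exact: cvg_id|exact: cvg_cst].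
  by rewrite subrr.
apply: near_eq_is_derive du; apply: filterS near_d => t td.
by rewrite /= /c extend_id // /b cinvK //; exact: tu.
Qed.

(** The reparametrized curve s |-> c(ts) is a subgroup with velocity [t *: X], so the choice in
    [lie_exp] does not fall back on its default, and uniqueness makes its result c(t). *)
Lemma lie_expE (X : E) (c : R -> G) (t : R) : additive_curve c -> continuous c ->
  is_derive (0 : R^o) (1 : R^o) (cmap c1 \o c) X ->
  lie_exp (t *: X : lie_algebra G) = c t.
Proof.
move=> hc cc dc; pose b (s : R) := c (t * s).
have hb : additive_curve b by move=> s r; rewrite /b mulrDr hc.
have cb : continuous b.
  move=> s; apply: (@continuous_comp _ _ _ (fun s : R => t * s) c); last exact: cc.
  exact: mulrl_continuous.
have b0 := additive_curve0 hb.
have db : is_derive (0 : R^o) (1 : R^o) (cmap c1 \o b) (t *: X).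
  have [dd <-] := dc; pose sc (s : R^o) : R^o := t * s.
  have ds : is_derive (0 : R^o) (1 : R^o) sc t.
    have [h e] := is_deriveZ t (is_derive_id (0 : R^o) (1 : R^o)).
    by apply: DeriveDef; [exact: h|exact: etrans e (mulr1 t)].
  have df : differentiable (cmap c1 \o c) (sc 0).
    by rewrite /sc mulr0; apply/derivable1_diffP.
  have E1 := derive_real_direction t df.
  have E2 : sc 0 = 0 by rewrite /sc mulr0.
  by have := is_derive_curve df ds; rewrite E1 E2.
have ob : one_parameter_subgroup (t *: X : lie_algebra G) b.
  split => //; first exact: additive_smooth_curve hb cb db.
  by have [_ <-] := db; rewrite /velocity b0 derive1E.
have ex : exists x : G, [set x | exists2 c : R -> G,
    one_parameter_subgroup (t *: X : lie_algebra G) c & x = c 1] x.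
  by exists (b 1), b.
have [b' ob' e'] := xgetPex 1%g ex; rewrite /lie_exp e'.
have [hb' cb' db'] := one_parameter_subgroupP ob'.
by rewrite (additive_curve_unique hb' hb cb' cb db' db) /b mulr1.
Qed.

End Existence.
Local Opaque derive1.

(** * The Chern connection of a Finsler function *)

Section FinslerFunction.
Context {R : realType} {n : nat}.
Local Notation E := 'rV[R]_n.
Implicit Types (f h : E * E -> R^o) (Omega : set (E * E)) (z w : E * E).

Definition vdir (v : E) : E * E := (0, v).
Local Notation yb i := (vdir (@ebase R n i)).
Local Notation xb k := ((@ebase R n k, 0) : E * E).

Lemma derive1_affine (F : normedModType R) (h : E * E -> F) (A : R^o -> E * E)
    (v : E * E) t :
  (forall s r : R, A (s + r) = s *: v + A r) -> derive1 (h \o A) t = 'D_v h (A t).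
Proof.
move=> HA; rewrite derive1E.
apply: (derive_comp_affine (L := fun _ : R^o => v)) => s.
by rewrite [s *: _]mulr1 HA.
Qed.

(** Expresses the tensor by vertical directional derivatives on the product space, where Schwarz
    symmetry and Euler's identities are available. *)
Lemma fundamental_tensorE f (p y u v : E) :
  fundamental_tensor (fun y => f (p, y)) y u v =
  2^-1 * 'D_(vdir u) ('D_(vdir v) (fun z => f z ^+ 2 : R^o)) (p, y).
Proof.
pose S (z : E * E) : R^o := f z ^+ 2.
have affine (q v' : E) (r a : R) :
    (p, q + (a + r) *: v') = a *: vdir v' + (p, q + r *: v').
  apply: injective_projections => /=; first by rewrite scaler0 add0r.
  by rewrite scalerDl addrCA.
have inner s : derive1 (fun t : R => (f (p, y + s *: u + t *: v) ^+ 2 : R^o)) 0 =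
    'D_(vdir v) S (p, y + s *: u).
  have := @derive1_affine R^o S (fun t : R^o => (p, y + s *: u + t *: v)) (vdir v) 0.
  by rewrite scale0r addr0; apply => r q; exact: affine.
have outer : derive1 (fun s : R =>
    derive1 (fun t : R => (f (p, y + s *: u + t *: v) ^+ 2 : R^o)) 0) 0 =
    'D_(vdir u) ('D_(vdir v) S) (p, y).
  rewrite (_ : (fun s => _) = (fun s : R => 'D_(vdir v) S (p, y + s *: u)));
    last by apply/funext => s; exact: inner.
  have := @derive1_affine R^o ('D_(vdir v) S) (fun t : R^o => (p, y + t *: u))
    (vdir u) 0.
  by rewrite scale0r addr0; apply => r q; exact: affine.
by rewrite /fundamental_tensor outer.
Qed.

Lemma derive_vdir_sum (h : E * E -> R^o) z (v : E) : differentiable h z ->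
  'D_(vdir v) h z = \sum_i v 0 i * 'D_(yb i) h z.
Proof.
move=> dh; rewrite deriveE //.
have -> : vdir v = \sum_i v 0 i *: yb i.
  apply: injective_projections.
    by rewrite [RHS]raddf_sum /= big1 // => i _; rewrite scaler0.
  rewrite [RHS]raddf_sum /= {1}(row_sum_delta v).
  by apply: eq_bigr.
by rewrite linear_sum; apply: eq_bigr => i _; rewrite linearZ deriveE.
Qed.

Lemma derive_contraction (h : 'I_n -> E * E -> R^o) z w :
  (forall j, differentiable (h j) z) ->
  'D_w (fun z => \sum_j z.2 0 j * h j z : R^o) z =
  \sum_j (w.2 0 j * h j z + z.2 0 j * 'D_w (h j) z).
Proof.
move=> dh.
pose co j (z : E * E) : R^o := z.2 0 j.
have aff j (a : R) : co j (a *: w + z) = a *: (w.2 0 j : R^o) + co j z.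
  by rewrite /co /= !mxE.
have dco j : is_derive z w (co j) (w.2 0 j).
  apply: DeriveDef.
    exact: (@derivable_comp_affine _ R^o _ R^o (co j) (fun w => w.2 0 j) id).
  rewrite (@derive_comp_affine _ R^o _ R^o (co j) (fun w => w.2 0 j) id) //.
  exact: derive_id.
have dj j : is_derive z w (co j * h j) (w.2 0 j * h j z + z.2 0 j * 'D_w (h j) z).
  have dhj : is_derive z w (h j) ('D_w (h j) z).
    exact/derivableP/diff_derivable.
  apply: is_derive_eq (is_deriveM (dco j) dhj) _.
  by rewrite addrC [_ *: w.2 0 j]mulrC.
rewrite (_ : (fun z => _) = \sum_j (co j * h j)); last first.
  by apply/funext => q; rewrite fct_sumE.
by have [_ ->] := is_derive_sum dj.
Qed.

Lemma derive_eq_on (Omega : set (E * E)) (g h : E * E -> R^o) z w : open Omega ->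
  (forall z, Omega z -> g z = h z) -> Omega z -> 'D_w g z = 'D_w h z.
Proof. by move=> oO gh Oz; exact: near_eq_derive (open_near_eq oO gh Oz). Qed.

End FinslerFunction.

(** * Euler's identities and the geodesic spray *)

Section Homogeneous.
Context {R : realType} {n : nat}.
Local Notation E := 'rV[R]_n.
Local Notation yb i := (vdir (@ebase R n i)).
Local Notation xb k := ((@ebase R n k, 0) : E * E).
Context (f : E * E -> R^o) (D : set E).

Definition slit : set (E * E) := [set z | D z.1 /\ z.2 != 0].

Definition energy (z : E * E) : R^o := f z ^+ 2.

Hypothesis openD : open D.
Hypothesis f_smooth : smooth_on slit f.
Hypothesis f_homogeneous :
  forall p y (t : R), 0 <= t -> f (p, t *: y) = t * f (p, y).
Implicit Types (z w : E * E).

Lemma open_slit : open slit.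
Proof.
rewrite openE => -[p y] [/= Dp y0]; rewrite /interior.
have n1 : \forall z \near (p, y), D z.1.
  by apply: (cvg_fst (F := nbhs p) (G := nbhs y)); exact: open_nbhs_nbhs.
have n2 : \forall z \near (p, y), z.2 != 0.
  have c : {for (p, y), continuous (snd : E * E -> E)} by exact: cvg_snd.
  exact: (cvgr_neq0 _ c y0).
by apply: filterS2 n1 n2 => z h1 h2; split.
Qed.

Lemma energy_smooth : smooth_on slit energy.
Proof.
move=> k; rewrite (_ : energy = f * f); last by apply/funext => z; rewrite /energy expr2.
by apply: Ck_onM; [exact: open_slit|exact: f_smooth|exact: f_smooth].
Qed.

Let d1 z : slit z -> differentiable energy z.
Proof. by move=> Oz; exact: smooth_on_differentiable energy_smooth Oz. Qed.

Let d2 z w : slit z -> differentiable ('D_w energy) z.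
Proof.
move=> Oz; have S1 := smooth_on_derive w energy_smooth.
exact: smooth_on_differentiable S1 Oz.
Qed.

Let d3 z w w' : slit z -> differentiable ('D_w ('D_w' energy)) z.
Proof.
move=> Oz; have S1 := smooth_on_derive w' energy_smooth.
have S2 := smooth_on_derive w S1.
exact: smooth_on_differentiable S2 Oz.
Qed.

Lemma derive_fiber_homogeneous z : slit z -> 'D_(vdir z.2) f z = f z.
Proof.
move=> Oz; have df := smooth_on_differentiable f_smooth Oz.
have := @is_derive_line _ _ _ f z (vdir z.2) 0; rewrite scale0r add0r.
move=> /(_ (diff_derivable df)) h1.
have did : differentiable (id : R^o -> R^o) (0 *: f z + f z) by [].
have h2 := is_derive_line (diff_derivable (v := f z) did).
rewrite derive_id in h2.
have nn : \forall s \near (0 : R^o), f (s *: vdir z.2 + z) = s *: f z + f z.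
  (* Homogeneity holds for nonnegative factors, and the factor here is [s + 1]. *)
  have n0 : \forall s \near (0 : R^o), -1 < s.
    by apply: lt_nbhsr; rewrite ltrN10.
  apply: filterS n0 => s s1.
  have -> : s *: vdir z.2 + z = (z.1, (s + 1) *: z.2).
    by apply: injective_projections; rewrite /= ?scaler0 ?add0r // scalerDl scale1r.
  rewrite f_homogeneous; last by lra.
  by rewrite mulrDl mul1r -surjective_pairing.
have [_ <-] := near_eq_is_derive nn h1.
by have [_ ->] := h2.
Qed.

Lemma euler_energy z : slit z -> \sum_j z.2 0 j * 'D_(yb j) energy z = 2 * energy z.
Proof.
move=> Oz; rewrite -derive_vdir_sum; last exact: d1.
have df := smooth_on_differentiable f_smooth Oz.
rewrite (_ : energy = f * f); last by apply/funext => q; rewrite /energy expr2.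
rewrite deriveM; [|exact: diff_derivable|exact: diff_derivable].
by rewrite derive_fiber_homogeneous // -mulr2n mulr_natl.
Qed.

(** Euler's identity holds on an open set and may be differentiated. Vertical and horizontal choices
    of [w] then give the homogeneity of the first derivatives in y and in x. *)
Lemma euler_energy_derive z w : slit z ->
  \sum_j (w.2 0 j * 'D_(yb j) energy z + z.2 0 j * 'D_w ('D_(yb j) energy) z) =
  2 * 'D_w energy z.
Proof.
move=> Oz; rewrite -derive_contraction; last by move=> j; exact: d2.
rewrite (derive_eq_on (h := 2 \*: energy) w open_slit _ Oz); last exact: euler_energy.
by rewrite deriveZ //; apply: diff_derivable; exact: d1.
Qed.

Lemma sum_ebase i (c : 'I_n -> R) : \sum_j @ebase R n i 0 j * c j = c i.
Proof.
rewrite (bigD1 i) //= !mxE !eqxx mul1r big1 ?addr0 // => j ji.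
by rewrite mxE (negbTE ji) andbF mul0r.
Qed.

Lemma sum_cancel (A B : 'I_n -> R) (c : R) :
  \sum_j (A j + B j) = c -> \sum_j A j = c -> \sum_j B j = 0.
Proof.
rewrite big_split /= => AB Ac; rewrite Ac in AB.
by apply: (addrI c); rewrite addr0.
Qed.

Lemma xdir_snd k (j : 'I_n) (a b : R) : (xb k).2 0 j * a + b = b.
Proof. by rewrite mxE mul0r add0r. Qed.

Local Opaque ebase delta_mx.

Lemma euler_energy_y z i : slit z ->
  \sum_j z.2 0 j * 'D_(yb i) ('D_(yb j) energy) z = 'D_(yb i) energy z.
Proof.
move=> Oz; have := euler_energy_derive (yb i) Oz.
rewrite big_split /= sum_ebase => /eqP.
by rewrite mulrDl !mul1r => /eqP /addrI.
Qed.

Lemma euler_energy_x z k : slit z ->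
  \sum_j z.2 0 j * 'D_(xb k) ('D_(yb j) energy) z = 2 * 'D_(xb k) energy z.
Proof.
move=> Oz; rewrite -euler_energy_derive //; apply: eq_bigr => j _.
exact: esym (xdir_snd _ _ _ _).
Qed.

Lemma energy_symmetric z w w' : slit z ->
  'D_w ('D_w' energy) z = 'D_w' ('D_w energy) z.
Proof. by move=> Oz; exact: derive_symmetric open_slit (energy_smooth 2) Oz. Qed.

Lemma euler_hessian_derive z w i : slit z ->
  \sum_j (w.2 0 j * 'D_(yb i) ('D_(yb j) energy) z +
          z.2 0 j * 'D_w ('D_(yb i) ('D_(yb j) energy)) z) =
  'D_w ('D_(yb i) energy) z.
Proof.
move=> Oz; rewrite -derive_contraction; last by move=> j; exact: d3.
by apply: derive_eq_on open_slit _ Oz => q Oq; exact: euler_energy_y.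
Qed.

(** The fiber Hessian is homogeneous of degree 0. Up to a factor this says that the Cartan tensor
    vanishes on the position vector. *)
Lemma euler_hessian_y z i l : slit z ->
  \sum_j z.2 0 j * 'D_(yb l) ('D_(yb i) ('D_(yb j) energy)) z = 0.
Proof.
move=> Oz; have H := euler_hessian_derive (yb l) i Oz.
have Q1 := etrans (sum_ebase l (fun j => 'D_(yb i) ('D_(yb j) energy) z))
  (energy_symmetric (yb i) (yb l) Oz).
exact: sum_cancel H Q1.
Qed.

Lemma euler_hessian_x z i k : slit z ->
  \sum_j z.2 0 j * 'D_(xb k) ('D_(yb i) ('D_(yb j) energy)) z =
  'D_(xb k) ('D_(yb i) energy) z.
Proof.
move=> Oz; rewrite -euler_hessian_derive //; apply: eq_bigr => j _.
exact: esym (xdir_snd _ _ _ _).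
Qed.

Lemma g_loE i j z : g_lo f i j z = 2^-1 * 'D_(yb i) ('D_(yb j) energy) z.
Proof. by rewrite /g_lo fundamental_tensorE -surjective_pairing. Qed.

Lemma derive_g_lo i j z w : slit z ->
  'D_w (g_lo f i j : E * E -> R^o) z = 2^-1 * 'D_w ('D_(yb i) ('D_(yb j) energy)) z.
Proof.
move=> Oz; rewrite (_ : g_lo f i j = 2^-1 \*: 'D_(yb i) ('D_(yb j) energy)).
  by rewrite deriveZ //; apply: diff_derivable; exact: d3.
by apply/funext => q; exact: g_loE.
Qed.

Lemma dx_g_lo i j k z : slit z ->
  dx k (g_lo f i j) z = 2^-1 * 'D_(xb k) ('D_(yb i) ('D_(yb j) energy)) z.
Proof. exact: derive_g_lo. Qed.

Lemma dy_g_lo i j k z : slit z ->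
  dy k (g_lo f i j) z = 2^-1 * 'D_(yb k) ('D_(yb i) ('D_(yb j) energy)) z.
Proof. exact: derive_g_lo. Qed.

Lemma g_lo_symmetric i j z : slit z -> g_lo f i j z = g_lo f j i z.
Proof. by move=> Oz; rewrite !g_loE energy_symmetric. Qed.

Local Opaque g_lo nonlinear_connection g_up dx dy.

Lemma delta_x_congr k (g h : E * E -> R) z : dx k g z = dx k h z ->
  (forall l, dy l g z = dy l h z) -> delta_x f k g z = delta_x f k h z.
Proof.
move=> gx gy; rewrite /delta_x gx; congr (_ - _).
by apply: eq_bigr => l _; rewrite gy.
Qed.

Lemma delta_x_g_lo_symmetric k i j z : slit z ->
  delta_x f k (g_lo f i j) z = delta_x f k (g_lo f j i) z.
Proof.
move=> Oz.
have sym w : 'D_w (g_lo f i j : E * E -> R^o) z = 'D_w (g_lo f j i : E * E -> R^o) z.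
  by apply: derive_eq_on open_slit _ Oz => q; exact: g_lo_symmetric.
have symx : dx k (g_lo f i j) z = dx k (g_lo f j i) z by exact: sym.
have symy l : dy l (g_lo f i j) z = dy l (g_lo f j i) z by exact: sym.
exact: delta_x_congr symx symy.
Qed.

(* The nonlinear connection drops out because the vertical derivatives of
   [g_lo] are annihilated by the position vector. *)
Lemma delta_x_contraction k i z : slit z ->
  \sum_j delta_x f k (g_lo f i j) z * z.2 0 j =
  2^-1 * 'D_(xb k) ('D_(yb i) energy) z.
Proof.
move=> Oz; rewrite /delta_x.
under eq_bigr do rewrite mulrBl mulr_suml.
rewrite big_split /= sumrN exchange_big /= [X in _ - X]big1 ?subr0; last first.
  move=> l _.
  have H := euler_hessian_y i l Oz.
  transitivity (nonlinear_connection f l k z * (2^-1 *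
    \sum_j z.2 0 j * 'D_(yb l) ('D_(yb i) ('D_(yb j) energy)) z)).
    rewrite !mulr_sumr; apply: eq_bigr => j _.
    by rewrite (dy_g_lo i j l Oz); ring.
  by rewrite H !mulr0.
rewrite -euler_hessian_x // mulr_sumr; apply: eq_bigr => j _.
by rewrite (dx_g_lo i j k Oz); ring.
Qed.

Local Opaque delta_x.

(** The right side is the spray coefficient, often written 2 G^i. Of the three terms of the
    connection, the first and third have equal contractions by symmetry of g, so A - B + C = 2A - B;
    degree 2 homogeneity identifies B with the x-derivative of the energy. *)
Lemma chern_coef_contraction i z : slit z ->
  \sum_j \sum_k chern_coef f i j k z * z.2 0 j * z.2 0 k =
  2^-1 * \sum_s g_up f i s z *
    (\sum_k z.2 0 k * 'D_(xb k) ('D_(yb s) energy) z - 'D_(xb s) energy z).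
Proof.
move=> Oz.
pose T s j k := (delta_x f k (g_lo f s j) z - delta_x f s (g_lo f j k) z +
  delta_x f j (g_lo f k s) z) * z.2 0 j * z.2 0 k.
transitivity (2^-1 * \sum_s g_up f i s z * \sum_j \sum_k T s j k).
  rewrite mulr_sumr.
  transitivity (\sum_s \sum_j \sum_k 2^-1 * (g_up f i s z * T s j k)).
    rewrite [RHS]exchange_big; apply: eq_bigr => j _ /=; rewrite [RHS]exchange_big.
    apply: eq_bigr => k _ /=; rewrite /chern_coef !mulr_sumr !mulr_suml.
    by apply: eq_bigr => s _; rewrite /T !mulrA.
  apply: eq_bigr => s _; rewrite !mulr_sumr; apply: eq_bigr => j _.
  by rewrite !mulr_sumr.
congr (_ * _); apply: eq_bigr => s _; congr (_ * _).
pose A := \sum_j \sum_k delta_x f k (g_lo f s j) z * z.2 0 j * z.2 0 k.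
pose B := \sum_j \sum_k delta_x f s (g_lo f j k) z * z.2 0 j * z.2 0 k.
pose C := \sum_j \sum_k delta_x f j (g_lo f k s) z * z.2 0 j * z.2 0 k.
have -> : \sum_j \sum_k T s j k = A - B + C.
  rewrite /A /B /C -sumrB -big_split; apply: eq_bigr => j _ /=.
  rewrite -sumrB -big_split; apply: eq_bigr => k _ /=.
  by rewrite /T mulrDl mulrBl mulrDl mulrBl.
have hA : A = \sum_k z.2 0 k * (2^-1 * 'D_(xb k) ('D_(yb s) energy) z).
  rewrite /A exchange_big; apply: eq_bigr => k _ /=.
  by rewrite -mulr_suml delta_x_contraction // mulrC.
have hC : C = A.
  rewrite hA; apply: eq_bigr => j _.
  apply: etrans (congr1 (fun a => z.2 0 j * a) (delta_x_contraction j s Oz)).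
  rewrite mulr_sumr; apply: eq_bigr => k _.
  have sw (a b c d : R) : a = d -> a * b * c = b * (d * c) by move=> ->; ring.
  exact: sw (delta_x_g_lo_symmetric j k s Oz).
have hB : B = 'D_(xb s) energy z.
  have H := euler_energy_x s Oz.
  transitivity (2^-1 * \sum_j z.2 0 j * 'D_(xb s) ('D_(yb j) energy) z); last first.
    by rewrite H mulrA mulVf ?mul1r // pnatr_eq0.
  rewrite mulr_sumr; apply: eq_bigr => j _; rewrite mulrCA.
  apply: etrans (congr1 (fun a => z.2 0 j * a) (delta_x_contraction s j Oz)).
  rewrite mulr_sumr; apply: eq_bigr => k _.
  have sw (a b c : R) : a * b * c = b * (a * c) by ring.
  exact: sw.
rewrite hC hB hA; set Q := \sum_(_ < n) _.
have -> : Q = 2^-1 * \sum_k z.2 0 k * 'D_(xb k) ('D_(yb s) energy) z.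
  by rewrite /Q mulr_sumr; apply: eq_bigr => k _; rewrite mulrCA.
by set P := \sum_k _; lra.
Qed.

Hypothesis f_convex : forall p y u, D p -> y != 0 -> u != 0 ->
  0 < fundamental_tensor (fun y => f (p, y)) y u u.

Lemma mulr_sum_coef (a : R) (b X : 'I_n -> R) :
  a * \sum_i b i * X i = \sum_i b i * (a * X i).
Proof. by rewrite mulr_sumr; apply: eq_bigr => i _; rewrite mulrCA. Qed.

Lemma fundamental_tensor_sum z u v : slit z ->
  fundamental_tensor (fun y => f (z.1, y)) z.2 u v =
  \sum_i u 0 i * \sum_j v 0 j * g_lo f i j z.
Proof.
move=> Oz; rewrite fundamental_tensorE -surjective_pairing.
have E1 := derive_vdir_sum u (d2 (vdir v) Oz).
apply: etrans (congr1 (fun a => 2^-1 * a) E1) _.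
apply: etrans (mulr_sum_coef _ _ _) _; apply: eq_bigr => i _.
apply: (congr1 (fun a => u 0 i * a)).
apply: etrans (congr1 (fun a => 2^-1 * a)
  (energy_symmetric (yb i) (vdir v) Oz)) _.
apply: etrans (congr1 (fun a => 2^-1 * a) (derive_vdir_sum v (d2 (yb i) Oz))) _.
apply: etrans (mulr_sum_coef _ _ _) _; apply: eq_bigr => j _.
apply: (congr1 (fun a => v 0 j * a)).
by apply: etrans (esym (g_loE j i z)) _; exact: g_lo_symmetric.
Qed.

(** A nonzero vector [v] in the kernel would have g(v, v) = 0, against positivity. *)
Lemma g_lo_unit z : slit z -> \matrix_(k, l) g_lo f k l z \in unitmx.
Proof.
move=> Oz; have [Dz z0] := Oz; rewrite -row_free_unit -kermx_eq0.
apply/rowV0P => v /sub_kermxP vG; apply/eqP/negPn/negP => v0.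
have := f_convex Dz z0 v0; rewrite fundamental_tensor_sum //.
have -> : \sum_i v 0 i * (\sum_j v 0 j * g_lo f i j z) = 0.
  apply: big1 => i _; have := congr1 (fun M : E => M 0 i) vG.
  rewrite !mxE => vGi; apply/eqP; rewrite mulf_eq0; apply/orP; right.
  apply/eqP; apply: etrans vGi.
  by apply: eq_bigr => j _; rewrite mxE (g_lo_symmetric i j Oz).
by rewrite ltxx.
Qed.

Lemma derive_pair_sum (h : E * E -> R^o) z (a b : E) : differentiable h z ->
  'D_(a, b) h z = \sum_k a 0 k * 'D_(xb k) h z + \sum_k b 0 k * 'D_(yb k) h z.
Proof.
move=> dh; rewrite -(derive_vdir_sum b dh).
have -> : (a, b) = (\sum_k a 0 k *: xb k) + vdir b.
  apply: injective_projections => /=.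
    rewrite addr0 raddf_sum /= {1}(row_sum_delta a).
    by apply: eq_bigr.
  by rewrite raddf_sum /= big1 ?add0r // => i _; rewrite scaler0.
rewrite !deriveE // linearD linear_sum; congr (_ + _).
by apply: eq_bigr => i _; rewrite linearZ deriveE.
Qed.

(** Expanding the Euler-Lagrange equation by the chain rule, with S_yy = 2g, shows that the bracket
    in the spray is -2 g T'. Multiplication by half the inverse of g leaves -T', which cancels the
    derivative of [T]. *)
Lemma chern_covariant_eq0 (c : R -> E) t :
  let T := derive1 c in
  let z := (c t, T t) in
  slit z ->
  (forall s, 'D_(T t, derive1 T t) ('D_(yb s) energy) z = 'D_(xb s) energy z) ->
  chern_covariant f c T T t = 0.
Proof.
move=> T z Oz EL; apply/rowP => i; rewrite !mxE.
rewrite (chern_coef_contraction i Oz).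
have EL' s : \sum_k z.2 0 k * 'D_(xb k) ('D_(yb s) energy) z - 'D_(xb s) energy z =
    - (2 * \sum_k derive1 T t 0 k * g_lo f k s z).
  have E1 := etrans (esym (derive_pair_sum (T t) (derive1 T t) (d2 (yb s) Oz))) (EL s).
  have E2 : \sum_k derive1 T t 0 k * 'D_(yb k) ('D_(yb s) energy) z =
      2 * \sum_k derive1 T t 0 k * g_lo f k s z.
    apply: esym; apply: etrans (mulr_sum_coef _ _ _) _; apply: eq_bigr => k _.
    apply: (congr1 (fun a => derive1 T t 0 k * a)).
    apply: etrans (congr1 (fun a => 2 * a) (g_loE k s z)) _.
    by rewrite mulrA mulfV ?mul1r // pnatr_eq0.
  have alg (a b d : R) : a + b = d -> a - d = - b by move=> <-; ring.
  exact: etrans (alg _ _ _ E1) (congr1 -%R E2).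
have GV := mulVmx (g_lo_unit Oz).
have E3 : \sum_s g_up f i s z * (\sum_k z.2 0 k * 'D_(xb k) ('D_(yb s) energy) z -
    'D_(xb s) energy z) = - (2 * derive1 T t 0 i).
  transitivity (- (2 * \sum_k derive1 T t 0 k * \sum_s g_up f i s z * g_lo f s k z)).
    rewrite mulr_sum_coef -sumrN.
    under eq_bigr do rewrite EL'.
    under [RHS]eq_bigr do rewrite mulrCA !mulr_sumr -sumrN.
    rewrite [RHS]exchange_big; apply: eq_bigr => s _ /=.
    rewrite mulrN mulrCA !mulr_sumr -sumrN; apply: eq_bigr => k _.
    by rewrite (g_lo_symmetric k s Oz); congr (- _); ring.
  congr (- (_ * _)); rewrite (bigD1 i) //= [X in _ + X]big1 ?addr0; last first.
    move=> k ki; have := congr1 (fun M : 'M[R]_n => M i k) GV.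
    rewrite !mxE eq_sym (negbTE ki) => E4.
    apply/eqP; rewrite mulf_eq0; apply/orP; right; apply/eqP; apply: etrans E4.
    by apply: eq_bigr => s _; rewrite mxE.
  have := congr1 (fun M : 'M[R]_n => M i i) GV; rewrite !mxE eqxx => E4.
  rewrite -[RHS]mulr1; congr (_ * _); apply: etrans E4.
  by apply: eq_bigr => s _; rewrite mxE.
by rewrite E3 mulrN mulrA mulVf ?pnatr_eq0 // mul1r subrr.
Qed.

End Homogeneous.

(** * The Euler-Lagrange equation of a bi-invariant metric *)

Section Invariance.
Context {R : realType} {n : nat} {G : lieGroupType R n}.
Local Notation E := 'rV[R]_n.
Local Notation c1 := (chart_at (1%g : G)).
Local Notation e0 := (cmap c1 (1%g : G)).
Local Notation yb i := (vdir (@ebase R n i)).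
Local Notation xb k := ((@ebase R n k, 0) : E * E).
Context (F : forall x : G, tangent x -> R).

Hypothesis F_finsler : finsler_metric F.
Hypothesis F_bi_invariant : bi_invariant F.

Implicit Types (phi : chart R n G) (X : E).

Lemma local_rep_homogeneous phi (p y : E) (t : R) : 0 <= t ->
  local_rep F phi (p, t *: y) = t * local_rep F phi (p, y).
Proof.
have [_ _ _ Fh _] := F_finsler.
by move=> t0; rewrite /local_rep /vec_of_chart /= linearZ Fh.
Qed.

Lemma fundamental_tensor_linear (V W : normedModType R) (A : {linear V -> W})
    (g : W -> R) y u v :
  fundamental_tensor (fun y => g (A y)) y u v =
  fundamental_tensor g (A y) (A u) (A v).
Proof.
have E1 : (fun s t : R => g (A (y + s *: u + t *: v))) =
    (fun s t : R => g (A y + s *: A u + t *: A v)).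
  by apply/funext => s; apply/funext => t; rewrite !linearD !linearZ.
exact: (congr1 (fun k : R -> R -> R => 2^-1 * derive1 (fun s : R =>
  derive1 (fun t : R => (k s t ^+ 2 : R^o)) 0) 0) E1).
Qed.

(** On a fiber, passing from components to tangent vectors is linear and injective, so positivity on
    the tangent space transfers. *)
Lemma local_rep_convex phi (p y u : E) : atlas phi -> target phi p -> y != 0 ->
  u != 0 -> 0 < fundamental_tensor (fun y => local_rep F phi (p, y)) y u u.
Proof.
move=> aphi tp y0 u0; have [_ _ _ _ Fc] := F_finsler.
have dx := cinv_dom tp.
have nz (v : E) : v != 0 -> vec_of_chart phi (cinv phi p) v != 0.
  by apply: contra_neq => h; exact: vec_of_chart_eq0 aphi dx h.
have := Fc _ _ _ (nz y y0) (nz u u0).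
by rewrite -fundamental_tensor_linear.
Qed.

Lemma local_rep_smooth phi : atlas phi -> smooth_on (slit (target phi)) (local_rep F phi).
Proof. by move=> aphi; have [_ _ Fs _ _] := F_finsler; exact: Fs. Qed.

Lemma local_rep_right_invariant phi (a : G) (p y : E) : atlas phi -> target phi p ->
  dom phi (cinv phi p * a)%g ->
  let psi := cmap phi \o (fun x : G => x * a)%g \o cinv phi in
  local_rep F phi (psi p, 'd psi p y) = local_rep F phi (p, y).
Proof.
move=> aphi tp da psi; have dx := cinv_dom tp.
have [_ Finv] := F_bi_invariant.
have := mdiff_chart y (rmul_mdifferentiable a (cinv phi p)) aphi aphi dx da.
rewrite (cinvK tp) -/psi => Hm.
have := Finv a (cinv phi p) (vec_of_chart phi (cinv phi p) y).
by rewrite Hm /local_rep /= (cmapK da).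
Qed.

Lemma local_rep_left_field phi X p : atlas phi -> target phi p ->
  local_rep F phi (p, left_field phi X p) = @F 1%g X.
Proof.
move=> aphi tp; have [Finv _] := F_bi_invariant.
have := left_invariant_field X Finv aphi (cinv_dom tp).
by rewrite (cinvK tp).
Qed.

Section AlongSubgroup.
Context (X : E) (c : R -> G) (phi : chart R n G) (t : R).
Hypothesis c_additive : additive_curve c.
Hypothesis c_continuous : continuous c.
Hypothesis c_derive : is_derive (0 : R^o) (1 : R^o) (cmap c1 \o c) X.
Hypothesis atlas_phi : atlas phi.
Hypothesis dom_phi : dom phi (c t).

Let u : R^o -> E := cmap phi \o c.
Let T : R^o -> E := derive1 u.
Let V : E -> E := left_field phi X.
Let S := energy (local_rep F phi).
Let z0 : E * E := (u t, T t).
Let m := chart_mul phi c1 phi.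
Let q (r : R^o) : E := cmap c1 (c (r - t)).

Let near_dom : \forall r \near (t : R^o), dom phi (c r).
Proof. by apply: c_continuous; exact: near_cmap. Qed.

Let du (r : R^o) : dom phi (c r) -> is_derive r (1 : R^o) u (V (u r)).
Proof. by move=> dr; exact: additive_curve_derive. Qed.

Let TE (r : R^o) : dom phi (c r) -> T r = V (u r).
Proof. by move=> /du [_ <-]; rewrite /T derive1E. Qed.

Let target_u (r : R^o) : dom phi (c r) -> target phi (u r).
Proof. exact: cmap_target. Qed.

Let V_smooth : smooth_on (target phi) V := left_field_smooth X atlas_phi.

Let dT : is_derive t (1 : R^o) T (derive1 T t).
Proof.
have dV := smooth_on_differentiable V_smooth (target_u dom_phi).
have h := is_derive_curve dV (du dom_phi).
have nT : \forall r \near (t : R^o), (V \o u) r = T r.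
  by apply: filterS near_dom => r dr; rewrite /= TE.
have [dT0 _] := near_eq_is_derive nT h.
apply: DeriveDef; [exact: dT0|exact: esym (derive1E T t)].
Qed.

(** Left translation by [c (- t)] takes the value of the field at [c t] back to [X], and its
    differential is linear. *)
Lemma left_field_neq0 : X != 0 -> V (u t) != 0.
Proof.
apply: contra_neq => V0.
have a1 := chart_at_atlas (1%g : G).
have ct : (c (- t) * c t)%g = 1%g.
  by rewrite -c_additive addNr additive_curve0.
have d1 : dom c1 (c (- t) * c t)%g by rewrite ct; exact: chart_at_dom.
have := left_field_lmul X atlas_phi a1 dom_phi d1.
rewrite -[left_field phi X _]/(V (u t)) V0 linear0 ct.
by rewrite (left_field1 X).
Qed.

Hypothesis X_neq0 : X != 0.

Let z0_slit : slit (target phi) z0.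
Proof.
split; first exact: target_u.
by rewrite /= TE //; exact: left_field_neq0.
Qed.

Let S_smooth : smooth_on (slit (target phi)) S.
Proof.
apply: energy_smooth; first exact: open_target.
exact: local_rep_smooth.
Qed.

Let q_derive : is_derive t (1 : R^o) q X.
Proof.
have := @is_derive_shifted R E (cmap c1 \o c) t (- t) X.
by rewrite subrr; apply; exact: c_derive.
Qed.

Let qt : q t = e0.
Proof. by rewrite /q subrr additive_curve0. Qed.

Let m_smooth : smooth_on (chart_mul_dom phi c1 phi) m.
Proof. by apply: chart_mul_smooth => //; exact: chart_at_atlas. Qed.

Let near_q : \forall r \near (t : R^o), dom c1 (c (r - t)).
Proof.
have cc : {for (t : R^o), continuous (fun r : R^o => c (r - t))}.
  apply: (@continuous_comp _ _ _ (fun s : R^o => s - t : R^o) c).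
    by apply: continuousB; [exact: cvg_id|exact: cvg_cst].
  exact: c_continuous.
by apply: cc; rewrite subrr additive_curve0 //; exact/near_cmap/chart_at_dom.
Qed.

Let psi (r : R^o) : E -> E :=
  cmap phi \o (fun x : G => x * c (r - t))%g \o cinv phi.

(** For [r] near [t] the translating element lies in the chart at the identity, so dependence on [r]
    is governed by the joint smoothness of the product. *)
Let psiE (r : R^o) : dom c1 (c (r - t)) -> psi r = (fun p => m (p, q r)).
Proof.
by move=> dr; apply/funext => p; rewrite /psi /m /chart_mul /q /= (cmapK dr).
Qed.

Let cinv_u (r : R^o) : dom phi (c r) -> cinv phi (u r) = c r.
Proof. exact: cmapK. Qed.

Let psi_u (r : R^o) : psi r (u t) = u r.
Proof.
rewrite /psi /= (cinv_u dom_phi) -c_additive.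
by rewrite addrC subrK.
Qed.

Let psi_diff (r : R^o) : dom phi (c r) -> differentiable (psi r) (u t).
Proof.
move=> dr; have [_ h] := rmul_mdifferentiable (c (r - t)) (c t).
apply: h => //; rewrite -c_additive.
by rewrite addrC subrK.
Qed.

(** Differentiate c(s) c(r - t) = c(s + r - t) in s at s = t. *)
Let psi_T (r : R^o) : dom phi (c r) -> 'd (psi r) (u t) (T t) = T r.
Proof.
move=> dr; rewrite TE // TE //.
have h1 := is_derive_curve (psi_diff dr) (du dom_phi).
rewrite deriveE in h1; last exact: psi_diff.
apply: is_derive_unique h1 _.
have h2 : is_derive t (1 : R^o) (fun s : R^o => u (s + (r - t))) (V (u r)).
    have := @is_derive_shifted R E u t (r - t) (V (u r)).
    by rewrite addrC subrK; apply; exact: du.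
apply: near_eq_is_derive h2; apply: filterS near_dom => s ds.
by rewrite /psi /= (cinv_u ds) -c_additive.
Qed.

(* Right translation by [c (r - t)] maps [u t] to [u r] and [T t] to [T r]. *)
Let fiber_invariance (r : R^o) (w : E) : dom phi (c r) ->
  'D_(vdir ('d (psi r) (u t) w)) S (u r, T r) = 'D_(vdir w) S z0.
Proof.
move=> dr; pose A y := (psi r (u t), 'd (psi r) (u t) y).
have inv : S \o A = S \o (fun y => (u t, y)).
  apply/funext => y; rewrite /S /energy /=; congr (_ ^+ 2).
  apply: local_rep_right_invariant => //; first exact: target_u.
  by rewrite (cinv_u dom_phi) -c_additive addrC subrK.
have h1 : 'D_w (S \o A) (T t) = 'D_(vdir ('d (psi r) (u t) w)) S (u r, T r).
  have <- : A (T t) = (u r, T r) by rewrite /A psi_T // psi_u.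
  apply: (derive_comp_affine (L := fun w => vdir ('d (psi r) (u t) w))) => h.
  by rewrite /A linearP; exact: pairr_affine.
have h2 : 'D_w (S \o (fun y => (u t, y))) (T t) = 'D_(vdir w) S z0.
  apply: (derive_comp_affine (L := fun w => vdir w)) => h.
  exact: pairr_affine.
have h3 : 'D_w (S \o A) (T t) = 'D_w (S \o (fun y => (u t, y))) (T t).
  exact: (congr1 (fun g : E -> R^o => 'D_w g (T t)) inv).
exact: etrans (esym h1) (etrans h3 h2).
Qed.

(* The mixed derivative of the product: by its symmetry it is both the
   derivative of [V] along [w] and the velocity of the right-translated [w]. *)
Let B (w : E) : E := 'D_(0 : E, X) ('D_(w, 0 : E) m) (u t, e0).

Let psi_derive (w : E) :
  is_derive t (1 : R^o) (fun r => 'd (psi r) (u t) w) (B w).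
Proof.
have dm : chart_mul_dom phi c1 phi (u t, e0).
  exact: chart_mul_dom1 (target_u dom_phi).
have dmw : differentiable ('D_(w, 0 : E) m) (u t, q t).
  by rewrite qt; exact: smooth_on_differentiable (smooth_on_derive _ m_smooth) dm.
have dpair := is_derive_pair (is_derive_cst (u t) (t : R^o) (1 : R^o)) q_derive.
have := is_derive_curve dmw dpair.
rewrite qt -/(B w); apply: near_eq_is_derive.
apply: filterS2 near_q near_dom => r dq dr.
(* The transported vector is the derivative of [m] along [(w, 0)] at [(u t, q r)]; only [q r]
   varies, with velocity [X] at [t], which yields the mixed derivative. *)
have dpsi := psi_diff dr; rewrite -(deriveE w dpsi) (psiE dq).
apply: esym; apply: (derive_comp_affine (A := fun p : E => (p, q r))
  (L := fun w : E => (w, 0 : E))) => h.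
exact: pairl_affine.
Qed.

Let psi_t (w : E) : 'd (psi t) (u t) w = w.
Proof.
apply: near_id_diff; apply: filterS (near_target (target_u dom_phi)) => p tp.
by rewrite /psi /= subrr additive_curve0 // mulg1 cinvK.
Qed.

(* Differentiate [fiber_invariance] in [r] at [t]. *)
Let right_identity i :
  'D_(vdir (B (@ebase R n i))) S z0 + 'D_(T t, derive1 T t) ('D_(yb i) S) z0 = 0.
Proof.
set w := @ebase R n i.
have dS z v : slit (target phi) z -> differentiable ('D_v S) z.
  by move=> Oz; exact: smooth_on_differentiable (smooth_on_derive v S_smooth) Oz.
have dS0 z : slit (target phi) z -> differentiable S z.
  by move=> Oz; exact: smooth_on_differentiable S_smooth Oz.
(* The vertical derivative of [S] along the transported vector is the pairing of its components [a]
   with the fiber gradient [b]. It is constant in [r], and the product rule at [t] gives the two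
   terms. *)
pose a j (r : R^o) : R^o := 'd (psi r) (u t) w 0 j.
pose b j (r : R^o) : R^o := 'D_(yb j) S (u r, T r).
have da j : is_derive t (1 : R^o) (a j) (B w 0 j).
  have [d e] := psi_derive w.
  apply: DeriveDef; first exact: derivable_coord d.
  by apply: etrans (derive_coord j d) _; rewrite e.
have db j : is_derive t (1 : R^o) (b j) ('D_(T t, derive1 T t) ('D_(yb j) S) z0).
  have dpair := is_derive_pair (du dom_phi) dT.
  have := is_derive_curve (dS z0 (yb j) z0_slit) dpair.
  by rewrite -TE.
have dab := is_derive_dot da db.
have near_slit : \forall r \near (t : R^o), slit (target phi) (u r, T r).
  have [dp _] := is_derive_pair (du dom_phi) dT.
  have cp : {for (t : R^o), continuous (fun r : R^o => (u r, T r))}.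
    by apply/differentiable_continuous/derivable1_diffP.
  apply: cp; apply: open_nbhs_nbhs; split; last exact: z0_slit.
  exact/open_slit/open_target.
have cst_ab : \forall r \near (t : R^o), \sum_j a j r * b j r = 'D_(vdir w) S z0.
  apply: filterS2 near_dom near_slit => r dr sr.
  have E1 := derive_vdir_sum ('d (psi r) (u t) w) (dS0 _ sr).
  have E2 := fiber_invariance w dr.
  by rewrite E1 in E2; exact: E2.
have E0 := is_derive_near_cst cst_ab dab.
have E1 := derive_vdir_sum (B w) (dS0 _ z0_slit).
have E2 := sum_ebase i (fun j => 'D_(T t, derive1 T t) ('D_(yb j) S) z0).
rewrite E1 -E2 -big_split; apply: etrans E0; apply: eq_bigr => j _.
by rewrite /a psi_t.
Qed.

(* [F] is constant along the left-invariant field [V]. *)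
Let left_identity i :
  'D_(xb i) S z0 + 'D_(vdir (B (@ebase R n i))) S z0 = 0.
Proof.
set w := @ebase R n i.
have dS0 := smooth_on_differentiable S_smooth z0_slit.
have dV := smooth_on_differentiable V_smooth (target_u dom_phi).
have z0E : z0 = (u t, V (u t)) by rewrite /z0 TE.
have dSV : differentiable S (u t, V (u t)) by rewrite -z0E.
have h1 : 'D_w (fun p => S (p, V p)) (u t) = 0.
  rewrite -(derive_cst (S (u t, V (u t))) (u t) w).
  apply: near_eq_derive.
  apply: filterS (near_target (target_u dom_phi)) => p tp /=.
  rewrite /S /energy /V !local_rep_left_field //; exact: target_u.
have DV : 'D_w V (u t) = B w.
  have E1 : 'D_w V (u t) = 'D_(w, 0 : E) ('D_(0 : E, X) m) (u t, e0).
    apply: (derive_comp_affine (A := fun p : E => (p, e0))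
      (L := fun w : E => (w, 0 : E))) => h.
    exact: pairl_affine.
  rewrite E1; apply: derive_symmetric_row (@open_chart_mul_dom _ _ _ phi c1 phi)
    (m_smooth 2) _.
  exact: chart_mul_dom1 (target_u dom_phi).
have := derive_graph w dV dSV; rewrite h1 DV -z0E => E1.
exact: etrans (esym (derive_pair_split w (B w) dS0)) (esym E1).
Qed.

Lemma euler_lagrange i :
  'D_(T t, derive1 T t) ('D_(yb i) S) z0 = 'D_(xb i) S z0.
Proof.
have h1 := right_identity i; have h2 := left_identity i.
have alg (a b d : R) : a + b = 0 -> d + a = 0 -> b = d.
  by move=> /eqP; rewrite addrC addr_eq0 => /eqP -> /eqP; rewrite addr_eq0 => /eqP.
exact: alg h1 h2.
Qed.

Lemma chern_geodesic_equation :
  chern_covariant (local_rep F phi) u T T t = 0.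
Proof.
apply: (@chern_covariant_eq0 _ _ (local_rep F phi) (target phi)) => //.
- exact: open_target.
- exact: local_rep_smooth.
- by move=> p y s s0; exact: local_rep_homogeneous.
- by move=> p y v tp y0 v0; exact: local_rep_convex.
- exact: euler_lagrange.
Qed.

End AlongSubgroup.

End Invariance.

Lemma velocity_additive_curve (R : realType) (n : nat) (G : lieGroupType R n)
    (X : 'rV[R]_n) (c : R -> G) t :
  additive_curve c -> continuous c ->
  is_derive (0 : R^o) (1 : R^o) (cmap (chart_at (1%g : G)) \o c) X ->
  velocity c t =
  left_field (chart_at (c t)) X (cmap (chart_at (c t)) (c t)) :> 'rV[R]_n.
Proof.
move=> hc cc dc.
have [_ <-] := additive_curve_derive hc cc dc (chart_at_atlas (c t)) (chart_at_dom _).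
by rewrite /velocity derive1E.
Qed.

Theorem theorem3p4 (R : realType) (n : nat) (G : lieGroupType R n)
    (F : forall x : G, tangent x -> R) :
  connected [set: G] ->
  finsler_metric F ->
  bi_invariant F ->
  forall X : lie_algebra G, X != 0 -> geodesic_vector F X.
Proof.
move=> _ Ff Fb X X0; split => //.
have [c [hc cc dc]] := @exists_additive_curve R n G X.
have -> : (fun t : R => lie_exp (t *: X)) = c.
  (* Each value [lie_exp (t *: X)] comes from its own choice of subgroup; all of them are read off
     the one curve [c]. *)
  by apply/funext => t; exact: lie_expE.
have vE t := velocity_additive_curve t hc cc dc.
split; first split.
- exact: additive_smooth_curve dc.
- move=> t; rewrite vE.
  exact: (left_field_neq0 hc (chart_at_atlas (c t)) (chart_at_dom (c t)) X0).
- move=> phi t aphi dphi T.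
  exact (chern_geodesic_equation Ff Fb hc cc dc aphi dphi X0).
(* The velocity is the left-invariant field at [c t], on which left invariance gives [F] its value
   at the identity. *)
exists (F 1%g X) => t.
have [Finv _] := Fb.
have H := left_invariant_field X Finv (chart_at_atlas (c t)) (chart_at_dom (c t)).
by rewrite vec_of_chart_at in H; rewrite vE.
Qed.
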